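(* Let $1<p<\infty$ and $0<\alpha_0\leq\alpha\leq1$. Assume that $\Omega\subset\mathbb{R}^n$ is of class $C^{1,\alpha}$ with $0\in\partial\Omega$, and that $u$ is a solution of the elliptic equation $$F(D^2u,x)=f(x)\quad\text{in }\Omega_1,\qquad f\in L^p(\Omega_1).\qquad(\ast)$$ Suppose that: (a) $F$ satisfies the interior $W^{2,p}$ estimate with constant $c_e$, that is, for any solution $v$ of $(\ast)$ and any ball $B_r(x_0)\subset\Omega_1$, $$\|D^2v\|_{L^p(B_{r/2}(x_0))}\leq c_e\left(r^{n/p-2}\|v\|_{L^\infty(B_r(x_0))}+\|f\|_{L^p(B_r(x_0))}\right);$$ (b) $u$ satisfies the pointwise boundary $C^{1,\alpha_0}$ estimate with constant $c_b$, that is, for any $x_0\in(\partial\Omega)_{1/2}$ there exists an affine function $l_{x_0}$ such that $$|(u-l_{x_0})(x)|\leq c_b|x-x_0|^{1+\alpha_0}\ \text{ for all }x\in\Omega_1\quad\text{and}\quad|Dl_{x_0}|\leq c_b.$$ Then: (i) If $\alpha_0>1-1/p$, then $$\|D^2u\|_{L^p(\Omega_{1/12})}\leq C\left(1+\|f\|_{L^p(\Omega_1)}\right),$$ where $C$ depends only on $n,\alpha_0,p,c_e,c_b$ and $\Omega$. (ii) If $\alpha_0\leq1-1/p$, then for any $1\leq p_0<1/(1-\alpha_0)$, $$\|D^2u\|_{L^{p_0}(\Omega_{1/12})}\leq C\left(1+\|f\|_{L^p(\Omega_1)}\right),$$ where $C$ depends only on $n,\alpha_0,p,p_0,c_e,c_b$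 and $\Omega$.
   Context: Notation: $B_r(x_0)=\{x\in\mathbb{R}^n:|x-x_0|<r\}$, $B_r=B_r(0)$, $\Omega_r=\Omega\cap B_r$, $(\partial\Omega)_r=\partial\Omega\cap B_r$; $x=(x',x^n)$ with $x'\in\mathbb{R}^{n-1}$, and $B_1'=\{x'\in\mathbb{R}^{n-1}:|x'|<1\}$. Standing assumption: there is $\varphi\in C^{1,\alpha}(B_1')$ such that $\Omega_1=\{x^n>\varphi(x')\}\cap B_1$ and $(\partial\Omega)_1=\{x^n=\varphi(x')\}\cap B_1$. $F=F(M,x)$ is a fully nonlinear elliptic operator, a function of a symmetric matrix $M$ and of $x\in\Omega_1$; ''solution'' is understood in one fixed sense (strong or viscosity) for both $u$ and $v$. *)

(* Defs.v *)
From HB Require Import structures.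
From mathcomp Require Import all_boot all_order all_algebra.
From mathcomp Require Import all_classical all_reals all_analysis.
Import Order.TTheory GRing.Theory Num.Theory.
Import numFieldNormedType.Exports.

Set Implicit Arguments.
Unset Strict Implicit.
Unset Printing Implicit Defensive.

Local Open Scope classical_set_scope.
Local Open Scope ring_scope.

Definition measure_rV_display : measure_display.
Proof. exact: default_measure_display. Qed.

(* The sigma-algebra generated by the coordinates, i.e., the Borel sets of R^n. *)
Section measurable_rV.
Context {R : realType} (n : nat).

Definition rV_coord (i : 'I_n) (x : 'rV[R]_n) : measurableTypeR R := x 0 i.

Let rV_set0 : g_sigma_preimage rV_coord set0.
Proof. exact: sigma_algebra0. Qed.

Let rV_setC A : g_sigma_preimage rV_coord A -> g_sigma_preimage rV_coord (~` A).
Proof. exact: sigma_algebraC. Qed.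

Let rV_bigcup (F : (set 'rV[R]_n)^nat) :
  (forall i, g_sigma_preimage rV_coord (F i)) ->
  g_sigma_preimage rV_coord (\bigcup_i (F i)).
Proof. exact: sigma_algebra_bigcup. Qed.

HB.instance Definition _ := @isMeasurable.Build measure_rV_display
  'rV[R]_n (g_sigma_preimage rV_coord) rV_set0 rV_setC rV_bigcup.

Lemma measurable_rV_coord i : measurable_fun setT (rV_coord i).
Proof.
move=> _ B mB; rewrite setTI; apply: sub_sigma_algebra => /=.
rewrite -bigcup_seq/=; exists i => /=; first by rewrite mem_index_enum.
by exists B => //; rewrite setTI.
Qed.

Lemma measurable_fun_rV d (T : measurableType d) (g : T -> 'rV[R]_n) :
  (forall i, measurable_fun setT (rV_coord i \o g)) -> measurable_fun setT g.
Proof.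
move=> mg.
have H : g_sigma_preimage (fun i => rV_coord i \o g) `<=` measurable.
  apply: smallest_sub; first exact: sigma_algebra_measurable.
  by rewrite -bigcup_seq/=; apply: bigcup_sub => i _ A [B mB <-]; exact: mg.
move=> _ A mA; apply: H.
by rewrite g_sigma_preimage_comp; exists A.
Qed.

End measurable_rV.

Definition rV_split (R : realType) (n : nat) (x : 'rV[R]_n.+1) :
    'rV[R]_n * measurableTypeR R :=
  (\row_j x 0 (lift ord_max j), x 0 ord_max).

Definition rV_join (R : realType) (n : nat) (z : 'rV[R]_n * measurableTypeR R) :
    'rV[R]_n.+1 :=
  \row_i (if unlift ord_max i is Some j then z.1 0 j else z.2).

Lemma rV_joinK (R : realType) (n : nat) : cancel (@rV_join R n) (@rV_split R n).
Proof.
move=> [y t]; rewrite /rV_split /rV_join !mxE unlift_none; congr pair.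
by apply/rowP => j; rewrite !mxE liftK.
Qed.

Lemma measurable_rV_join (R : realType) (n : nat) :
  measurable_fun setT (@rV_join R n).
Proof.
apply: measurable_fun_rV => i.
case: (unliftP ord_max i) => [j ->|->].
- rewrite (_ : _ \o _ = rV_coord j \o fst); last first.
    by apply/funext => z; rewrite /rV_coord /= mxE liftK.
  by apply: measurableT_comp => //; exact: measurable_rV_coord.
- rewrite (_ : _ \o _ = snd); first exact: measurable_snd.
  by apply/funext => z; rewrite /rV_coord /= mxE unlift_none.
Qed.

Lemma measurable_rV_split (R : realType) (n : nat) :
  measurable_fun setT (@rV_split R n).
Proof.
apply/measurable_fun_pairP; split.
- apply: measurable_fun_rV => i.
  rewrite (_ : _ \o _ = rV_coord (lift ord_max i)).
    exact: measurable_rV_coord.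
  by apply/funext => x; rewrite /rV_coord /= mxE.
- exact: measurable_rV_coord.
Qed.

Section lebesgue_rV_succ.
Context (R : realType) (n : nat).
Variable m : {sigma_finite_measure set 'rV[R]_n -> \bar R}.

Definition lebesgue_rV_succ : set 'rV[R]_n.+1 -> \bar R :=
  pushforward (m \x @lebesgue_measure R)%E (@rV_join R n).

Let lebesgue_rV_succ0 : lebesgue_rV_succ set0 = 0%E.
Proof. by rewrite /lebesgue_rV_succ /pushforward preimage_set0 measure0. Qed.

Let lebesgue_rV_succ_ge0 A : (0 <= lebesgue_rV_succ A)%E.
Proof. exact: (measure_ge0 (m \x @lebesgue_measure R)%E). Qed.

Let lebesgue_rV_succ_sigma_additive : semi_sigma_additive lebesgue_rV_succ.
Proof.
move=> F mF tF mUF; rewrite /lebesgue_rV_succ /pushforward preimage_bigcup.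
apply: measure_semi_sigma_additive.
- by move=> k; rewrite -[X in measurable X]setTI; exact: measurable_rV_join.
- apply/trivIsetP => /= i j _ _ ij; rewrite -preimage_setI.
  by move/trivIsetP : tF => /(_ _ _ _ _ ij) ->//; rewrite preimage_set0.
- rewrite -preimage_bigcup -[X in measurable X]setTI.
  exact: measurable_rV_join.
Qed.

HB.instance Definition _ := isMeasure.Build _ _ _ lebesgue_rV_succ
  lebesgue_rV_succ0 lebesgue_rV_succ_ge0 lebesgue_rV_succ_sigma_additive.

Let lebesgue_rV_succ_sigma_finite : sigma_finite setT lebesgue_rV_succ.
Proof.
have /sigma_finiteP[F [TF ndF Foo]] := sigma_finiteT m.
have /sigma_finiteP[G [TG ndG Goo]] := sigma_finiteT (@lebesgue_measure R).
exists (fun k => @rV_split R n @^-1` (F k `*` G k)).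
  rewrite -preimage_bigcup -[LHS](@preimage_setT _ _ (@rV_split R n)).
  congr preimage; rewrite -setXTT TF TG predeqE => -[x y]; split.
    move=> [/= [k _ Fkx] [l _ Gly]]; exists (maxn k l) => //; split.
    - by move: x Fkx; exact/subsetPset/ndF/leq_maxl.
    - by move: y Gly; exact/subsetPset/ndG/leq_maxr.
  by move=> [k _ []/= ? ?]; split; exists k.
move=> k; have [mF Fk] := Foo k; have [mG Gk] := Goo k; split.
  rewrite -[_ @^-1` _]setTI; apply: measurable_rV_split => //.
  exact: measurableX.
rewrite /lebesgue_rV_succ /pushforward -comp_preimage.
rewrite (_ : _ \o _ = id); last by apply/funext => z; exact: rV_joinK.
by rewrite preimage_id product_measure1E// lte_mul_pinfty// ge0_fin_numE.
Qed.

HB.instance Definition _ := Measure_isSigmaFinite.Build _ _ _ lebesgue_rV_succ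
  lebesgue_rV_succ_sigma_finite.

End lebesgue_rV_succ.

Fixpoint lebesgue_rV (R : realType) (n : nat) :
    {sigma_finite_measure set 'rV[R]_n -> \bar R} :=
  match n with
  | 0 => @dirac _ 'rV[R]_0 0 R
  | k.+1 => @lebesgue_rV_succ R k (@lebesgue_rV R k)
  end.

Section euclidean.
Context {R : realType}.

(* The library norm on 'rV[R]_n is the sup norm (same topology). *)
Definition enorm n (x : 'rV[R]_n) : R := Num.sqrt (\sum_i x 0 i ^+ 2).

Definition eball n (x0 : 'rV[R]_n) (r : R) : set 'rV[R]_n :=
  [set x | enorm (x - x0) < r].

Definition frobenius n (M : 'M[R]_n) : R :=
  Num.sqrt (\sum_i \sum_j M i j ^+ 2).

Definition boundary n (O : set 'rV[R]_n) : set 'rV[R]_n :=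
  closure O `\` interior O.

Definition psd n (M : 'M[R]_n) : Prop :=
  forall z : 'rV[R]_n, 0 <= (z *m M *m z^T) 0 0.

End euclidean.

Section differentiability_classes.
Context {R : realType} {n : nat}.
Implicit Types (U : set 'rV[R]_n) (g : 'rV[R]_n -> R).

Definition partial (i : 'I_n) g : 'rV[R]_n -> R :=
  fun x => 'D_(delta_mx 0 i) g x.

Definition hessian g (x : 'rV[R]_n) : 'M[R]_n :=
  \matrix_(i, j) partial i (partial j g) x.

Definition C1_on U g : Prop := forall x, U x ->
  differentiable g x /\ forall i, {for x, continuous (partial i g)}.

Definition C2_on U g : Prop :=
  C1_on U g /\ forall i, C1_on U (partial i g).

(* Hoelder continuity of the gradient is required on compact subsets of U, as
   in Gilbarg-Trudinger; a finite C^{1,alpha} norm on U is a special case. *)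
Definition C1alpha_on (alpha : R) U g : Prop :=
  (forall x, U x -> differentiable g x) /\
  forall K, compact K -> K `<=` U -> exists L : R,
    forall x y i, K x -> K y ->
      `|partial i g x - partial i g y| <= L * enorm (x - y) `^ alpha.

(* C^k functions on R^n vanishing outside a compact subset of U. *)
Definition C1_compact U g : Prop := C1_on setT g /\
  exists K, [/\ compact K, K `<=` U & forall x, ~ K x -> g x = 0].

Definition C2_compact U g : Prop := C2_on setT g /\
  exists K, [/\ compact K, K `<=` U & forall x, ~ K x -> g x = 0].

End differentiability_classes.

Section domains.
Context {R : realType} {n : nat}.
Implicit Types Omega : set 'rV[R]_n.+1.

Definition ball_part Omega (r : R) := Omega `&` eball 0 r.

Definition bdry_part Omega (r : R) := boundary Omega `&` eball 0 r.

Definition C1alpha_domain (alpha : R) Omega : Prop :=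
  exists2 phi : 'rV[R]_n -> R, C1alpha_on alpha (eball 0 1) phi &
    ball_part Omega 1 =
      [set x | phi (rV_split x).1 < (rV_split x).2] `&` eball 0 1 /\
    bdry_part Omega 1 =
      [set x | (rV_split x).2 = phi (rV_split x).1] `&` eball 0 1.

End domains.

Section sobolev.
Context {R : realType} {n : nat}.
Implicit Types (U : set 'rV[R]_n) (u : 'rV[R]_n -> R)
  (G : 'rV[R]_n -> 'rV[R]_n) (H : 'rV[R]_n -> 'M[R]_n) (p : \bar R).
Local Notation mu := (lebesgue_rV R n).

Definition Lp_on p U u : Prop := u \_ U \in Lfun mu p.

Definition Lp_loc p U u : Prop :=
  forall K, compact K -> K `<=` U -> Lp_on p K u.

Definition Lp_norm p U u : \bar R := ('N[mu]_p[EFin \o (u \_ U)])%E.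

(* Weak derivatives of order k are tested against compactly supported C^k
   functions, as in Gilbarg-Trudinger. *)
Definition weak_gradient U u G : Prop :=
  [/\ Lp_loc 1 U u, forall i, Lp_loc 1 U (fun x => G x 0 i) &
      forall psi, C1_compact U psi -> forall i,
        \int[mu]_(x in U) (u x * partial i psi x) =
        - \int[mu]_(x in U) (G x 0 i * psi x)].

Definition weak_hessian U u H : Prop :=
  [/\ Lp_loc 1 U u, forall i j, Lp_loc 1 U (fun x => H x i j) &
      forall psi, C2_compact U psi -> forall i j,
        \int[mu]_(x in U) (u x * hessian psi x i j) =
        \int[mu]_(x in U) (H x i j * psi x)].

Definition W2p_loc p U u H : Prop :=
  [/\ Lp_loc p U u,
      exists2 G, weak_gradient U u G & forall i, Lp_loc p U (fun x => G x 0 i),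
      weak_hessian U u H &
      forall i j, Lp_loc p U (fun x => H x i j)].

(* ||D^2 u||_{L^p(U)}. Weak Hessians are unique a.e., so the infimum is over
   equal values; it is +oo when u has no weak Hessian on U. *)
Definition D2_norm p U u : \bar R :=
  ereal_inf [set Lp_norm p U (fun x => frobenius (H x)) | H in weak_hessian U u].

End sobolev.

Section fully_nonlinear.
Context {R : realType} {n : nat}.
Implicit Types (p : R) (U : set 'rV[R]_n) (F : 'M[R]_n -> 'rV[R]_n -> R)
  (f u : 'rV[R]_n -> R).
Local Notation mu := (lebesgue_rV R n).

(* Only the values of F at symmetric matrices are meaningful. *)
Definition elliptic U F : Prop :=
  forall x M N, U x -> M^T = M -> N^T = N -> psd (N - M) -> F M x <= F N x.

Definition strong_solution p U F f u : Prop :=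
  exists2 H, W2p_loc p%:E U u H & {ae mu, forall x, U x -> F (H x) x = f x}.

Definition C_viscosity_solution U F f u : Prop :=
  [/\ forall x, U x -> {for x, continuous u},
      forall phi x, C2_on U phi -> U x ->
        (\forall y \near x, u y - phi y <= u x - phi x) ->
        f x <= F (hessian phi x) x &
      forall phi x, C2_on U phi -> U x ->
        (\forall y \near x, u x - phi x <= u y - phi y) ->
        F (hessian phi x) x <= f x].

(* L^p-viscosity solutions, after Caffarelli-Crandall-Kocan-Swiech (whose F is
   nonincreasing in the matrix, hence the opposite signs). *)
Definition Lp_viscosity_solution p U F f u : Prop :=
  [/\ forall x, U x -> {for x, continuous u},
      forall phi H, (forall x, U x -> {for x, continuous phi}) ->
        W2p_loc p%:E U phi H ->
        forall (eps : R) O, 0 < eps -> open O -> O `<=` U ->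
        {ae mu, forall x, O x -> F (H x) x - f x <= - eps} ->
        forall x, O x -> ~ \forall y \near x, u y - phi y <= u x - phi x &
      forall phi H, (forall x, U x -> {for x, continuous phi}) ->
        W2p_loc p%:E U phi H ->
        forall (eps : R) O, 0 < eps -> open O -> O `<=` U ->
        {ae mu, forall x, O x -> eps <= F (H x) x - f x} ->
        forall x, O x -> ~ \forall y \near x, u x - phi x <= u y - phi y].

Inductive solution_sense := Strong | C_viscosity | Lp_viscosity.

Definition solution (s : solution_sense) p U F f u : Prop :=
  match s with
  | Strong => strong_solution p U F f u
  | C_viscosity => C_viscosity_solution U F f u
  | Lp_viscosity => Lp_viscosity_solution p U F f u
  end.

Definition interior_W2p_estimate s p (ce : R) U F f : Prop :=
  forall v x0 (r : R), solution s p U F f v -> 0 < r -> eball x0 r `<=` U ->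
    (D2_norm p%:E (eball x0 (r / 2)) v <=
     ce%:E * ((r `^ (n%:R / p - 2))%:E * Lp_norm +oo (eball x0 r) v +
              Lp_norm p%:E (eball x0 r) f))%E.

End fully_nonlinear.

Definition boundary_C1alpha_estimate (R : realType) (n : nat) (alpha cb : R)
    (Omega : set 'rV[R]_n.+1) (u : 'rV[R]_n.+1 -> R) : Prop :=
  forall x0, bdry_part Omega (1 / 2) x0 ->
    exists (a : R) (b : 'rV[R]_n.+1),
      (forall x, ball_part Omega 1 x ->
         `|u x - (a + \sum_i b 0 i * x 0 i)|
           <= cb * enorm (x - x0) `^ (1 + alpha)) /\
      enorm b <= cb.

(* Main.v *)
(* Subtracting the affine function of (b) from u changes neither the equation
   nor the Hessian.  On a ball of radius r whose distance to the boundary is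
   comparable to r, (a) together with |u - l| <= C r^(1+alpha0) therefore gives
     |D^2 u|_p^p <= C (r^(n+(alpha0-1)p) + |f|_p^p),
   and the same with the exponent of r for q <= p by splitting |D^2 u|^q at the
   level r^(alpha0-1).  Since the boundary is a Lipschitz graph, a Whitney cover
   has O(2^(k(n-1))) balls of size 2^-k, so that summing the q-th powers gives a
   convergent geometric series as soon as (1-alpha0) q < 1: (i) is the case
   q = p and (ii) the case q = p0. *)
Require Import Defs.
From HB Require Import structures.
From mathcomp Require Import all_boot all_order all_algebra.
From mathcomp Require Import all_classical all_reals all_analysis.
From mathcomp Require Import measurable_realfun ring lra.
Import Order.TTheory GRing.Theory Num.Theory.
Import numFieldNormedType.Exports.
Set Implicit Arguments.
Unset Strict Implicit.
Unset Printing Implicit Defensive.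
Local Open Scope classical_set_scope.
Local Open Scope ring_scope.

(** Hypothesis (a) only speaks of separate balls, and for viscosity solutions nothing provides a
    weak Hessian on the whole of [ball_part Omega (1 / 12)]. One has to be built, since the infimum
    defining [D2_norm] is infinite over the empty set. The local Hessians are glued into a single
    one that at every point is bounded, up to a dimensional factor, by one of the local ones; its
    [q]-th power is then at most the sum of the local ones over the balls. Splitting at the level
    r^(alpha0-1) alone would bound the [q]-th power by 1 + |f|_p^p, and the norm would not be linear
    in |f|_p when q < p. The level is therefore multiplied by N = 1 + |f|_p, after which all terms
    add up to a constant times N^q. Counting balls handles the powers of r but not the integrals of
    |f|^p: these need bounded overlap, which a colouring of the cover with finitely many colours
    supplies. *)

(** * Calculus of functions of class C1 and C2 *)

(** The difference [g - f] vanishes near [x], so it is differentiable there with zero differential,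
    and [g] is its sum with [f]. *)
Lemma near_eq_differentiable {R : numFieldType} {V W : normedModType R}
    (f g : V -> W) (x : V) :
  (\forall y \near x, f y = g y) -> differentiable f x -> differentiable g x.
Proof.
move=> fg df; rewrite -(subrK f g); apply: differentiableD => //.
have cont0 : continuous (0 : V -> W) by exact: cst_continuous.
have h0 : (g - f) \o shift x = cst ((g - f) x) + \0 +o_ 0 id.
  apply/eqaddoP => e e0; near=> h.
  rewrite [X in `|X|](_ : _ = 0) ?normr0 ?mulr_ge0 ?(ltW e0)//.
  rewrite -[LHS]/(g (h + x) - f (h + x) - (g x - f x + 0)).
  rewrite (nbhs_singleton fg) subrr addr0 subr0.
  suff -> : f (h + x) = g (h + x) by rewrite subrr.
  near: h; move: fg; rewrite (near_shift 0 x)/=.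
  by apply: filterS => y /=; rewrite subr0.
apply/diff_locallyP; have d0 : 'd (g - f) x = 0 :> (V -> W).
  exact: diff_unique.
by rewrite d0; split.
Unshelve. all: by end_near. Qed.

Section C1_C2_calculus.
Context {R : realType} {n : nat}.
Implicit Types (U : set 'rV[R]_n) (f g : 'rV[R]_n -> R) (x : 'rV[R]_n).

Lemma partial_eq_on U f g i : open U -> (forall x, U x -> f x = g x) ->
  forall x, U x -> partial i f x = partial i g x.
Proof.
move=> oU fg x Ux; apply: near_eq_derive.
by near=> y; apply: fg; near: y; exact: open_nbhs_nbhs.
Unshelve. all: by end_near. Qed.

Lemma continuous_at_eq_on U f g : open U -> (forall x, U x -> f x = g x) ->
  forall x, U x -> {for x, continuous f} -> {for x, continuous g}.
Proof.
move=> oU fg x Ux; rewrite /prop_for /continuous_at -(fg _ Ux).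
move=> cf; apply: cvg_trans cf; apply: (@near_eq_cvg _ _ (nbhs x)).
apply: (@filterS _ (nbhs x) _ U); last exact: open_nbhs_nbhs.
by move=> y; exact: fg.
Qed.

Lemma eq_C1_on U f g : open U -> (forall x, U x -> f x = g x) ->
  C1_on U f -> C1_on U g.
Proof.
move=> oU fg C1f x Ux; have [df cf] := C1f x Ux; split=> [|i].
  apply: near_eq_differentiable df.
  by near=> y; apply: fg; near: y; exact: open_nbhs_nbhs.
apply: (continuous_at_eq_on oU _ Ux (cf i)).
exact: partial_eq_on.
Unshelve. all: by end_near. Qed.

Lemma partialD f g x i : differentiable f x -> differentiable g x ->
  partial i (fun y => f y + g y) x = partial i f x + partial i g x.
Proof. by move=> df dg; rewrite /partial deriveD//; exact: diff_derivable. Qed.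

Lemma partialM f g x i : differentiable f x -> differentiable g x ->
  partial i (fun y => f y * g y) x =
  partial i f x * g x + f x * partial i g x.
Proof.
move=> df dg; rewrite /partial deriveM; [|exact: diff_derivable..].
by rewrite addrC; congr (_ + _); rewrite /GRing.scale/= mulrC.
Qed.

Lemma partial_comp (h : R -> R) f x i (dh : R) : differentiable f x ->
  is_derive (f x) 1 h dh ->
  partial i (fun y => h (f y)) x = dh * partial i f x.
Proof.
move=> df [hd hE]; have dfh : differentiable h (f x) by exact/derivable1_diffP.
have dhf : differentiable (h \o f) x by exact: differentiable_comp.
have -> : partial i (fun y => h (f y)) x = 'd (h \o f) x (delta_mx 0 i).
  by rewrite /partial -(deriveE _ dhf).
have -> : partial i f x = 'd f x (delta_mx 0 i) by rewrite /partial (deriveE _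
  df).
rewrite (diff_comp df dfh) /=.
rewrite -hE (deriveE _ dfh) -[X in 'd h _ X]mulr1.
by rewrite -[_ * 1]/(_ *: _) [LHS]linearZ mulrC.
Qed.

Lemma partial_cst (c : R) x i : partial i (cst c) x = 0.
Proof. by rewrite /partial derive_cst. Qed.

Lemma partial_coord x i j : partial i (fun y => y 0 j) x = (i == j)%:R.
Proof.
rewrite /partial; have @f : {linear 'rV[R]_n -> R}.
  by exists (fun N : 'rV[R]_n => N 0 j); do 2![eexists]; do ?[constructor];
     rewrite ?mxE// => ? *; rewrite ?mxE//; move=> ?; rewrite !mxE.
rewrite (_ : (fun _ => _) = f) // deriveE; last first.
  exact/linear_differentiable/coord_continuous.
rewrite diff_lin; last exact: coord_continuous.
by rewrite /f /= mxE eqxx/= eq_sym.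
Qed.

Lemma C1_on_continuous U f x : C1_on U f -> U x -> {for x, continuous f}.
Proof. by move=> C1f Ux; apply: differentiable_continuous; case: (C1f _ Ux). Qed.

Lemma C1_partial_continuous f i : C1_on setT f -> continuous (partial i f).
Proof. by move=> C1f x; have [_ cf] := C1f x I; exact: (cf i). Qed.

Lemma C1_onD U f g : open U -> C1_on U f -> C1_on U g ->
  C1_on U (fun y => f y + g y).
Proof.
move=> oU C1f C1g x Ux; have [df cf] := C1f x Ux; have [dg cg] := C1g x Ux.
split=> [|i]; first exact: differentiableD.
apply: (@continuous_at_eq_on U (fun y => partial i f y + partial i g y)) => //.
- move=> y Uy; rewrite partialD//; [by case: (C1f _ Uy)|by case: (C1g _ Uy)].
- exact: (continuousD (cf i) (cg i)).
Qed.

Lemma C1_onM U f g : open U -> C1_on U f -> C1_on U g ->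
  C1_on U (fun y => f y * g y).
Proof.
move=> oU C1f C1g x Ux; have [df cf] := C1f x Ux; have [dg cg] := C1g x Ux.
split=> [|i]; first exact: differentiableM.
apply: (@continuous_at_eq_on U
  (fun y => partial i f y * g y + f y * partial i g y)) => //.
- move=> y Uy; rewrite partialM//; [by case: (C1f _ Uy)|by case: (C1g _ Uy)].
- have Cf := C1_on_continuous C1f Ux; have Cg := C1_on_continuous C1g Ux.
  exact: (continuousD (continuousM (cf i) Cg) (continuousM Cf (cg i))).
Qed.

Lemma C1_on_cst U (c : R) : C1_on U (cst c).
Proof.
move=> x _; split=> [//|i].
rewrite (_ : partial i (cst c) = cst 0); first exact: cst_continuous.
by apply/funext => y; rewrite partial_cst.
Qed.

Lemma C1_on_coord U j : C1_on U (fun y => y 0 j).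
Proof.
move=> x _; split=> [|i]; first exact: differentiable_coord.
rewrite (_ : partial i _ = cst (i == j)%:R); first exact: cst_continuous.
by apply/funext => y; rewrite partial_coord.
Qed.

Lemma C1_on_comp U (h dh : R -> R) f : open U ->
  (forall t : R, is_derive t 1 h (dh t)) -> continuous dh ->
  C1_on U f -> C1_on U (fun y => h (f y)).
Proof.
move=> oU hdh cdh C1f x Ux; have [df cf] := C1f x Ux; split=> [|i].
  apply: (differentiable_comp df); apply/derivable1_diffP.
  by have [] := hdh (f x).
apply: (@continuous_at_eq_on U (fun y => dh (f y) * partial i f y)) => //.
- by move=> y Uy; rewrite (partial_comp i _ (hdh (f y)))//; case: (C1f _ Uy).
- have Cf := C1_on_continuous C1f Ux.
  apply: continuousM (cf i).
  exact: (continuous_comp Cf (cdh (f x))).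
Qed.

Lemma eq_C2_on U f g : open U -> (forall x, U x -> f x = g x) ->
  C2_on U f -> C2_on U g.
Proof.
move=> oU fg [C1f C2f]; split=> [|i]; first exact: eq_C1_on fg C1f.
by apply: eq_C1_on (C2f i) => // x Ux; exact: partial_eq_on fg _ Ux.
Qed.

Lemma C2_onD U f g : open U -> C2_on U f -> C2_on U g ->
  C2_on U (fun y => f y + g y).
Proof.
move=> oU [C1f C2f] [C1g C2g]; split=> [|i]; first exact: C1_onD.
apply: eq_C1_on (C1_onD oU (C2f i) (C2g i)) => // x Ux.
by rewrite partialD//; [case: (C1f _ Ux)|case: (C1g _ Ux)].
Qed.

Lemma C2_onM U f g : open U -> C2_on U f -> C2_on U g ->
  C2_on U (fun y => f y * g y).
Proof.
move=> oU [C1f C2f] [C1g C2g]; split=> [|i]; first exact: C1_onM.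
apply: eq_C1_on (C1_onD oU (C1_onM oU (C2f i) C1g) (C1_onM oU C1f (C2g i))) => //.
by move=> x Ux; rewrite partialM//; [case: (C1f _ Ux)|case: (C1g _ Ux)].
Qed.

Lemma C2_on_cst U (c : R) : C2_on U (cst c).
Proof.
split=> [|i]; first exact: C1_on_cst.
by rewrite (_ : partial i _ = cst 0); [exact: C1_on_cst|by apply/funext => y;
  rewrite partial_cst].
Qed.

Lemma C2_on_coord U j : C2_on U (fun y => y 0 j).
Proof.
split=> [|i]; first exact: C1_on_coord.
rewrite (_ : partial i _ = cst (i == j)%:R); first exact: C1_on_cst.
by apply/funext => y; rewrite partial_coord.
Qed.

Lemma C2_on_comp U (h dh ddh : R -> R) f : open U ->
  (forall t : R, is_derive t 1 h (dh t)) ->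
  (forall t : R, is_derive t 1 dh (ddh t)) -> continuous ddh ->
  C2_on U f -> C2_on U (fun y => h (f y)).
Proof.
move=> oU hdh dhddh cddh [C1f C2f].
have cdh : continuous dh.
  move=> t; apply: differentiable_continuous; apply/derivable1_diffP.
  by have [] := dhddh t.
split=> [|i]; first exact: C1_on_comp.
have C1dh := C1_on_comp oU dhddh cddh C1f.
apply: eq_C1_on (C1_onM oU C1dh (C2f i)) => // x Ux.
by rewrite (partial_comp i _ (hdh (f x)))//; case: (C1f _ Ux).
Qed.

Lemma C2_on_sum U (I : Type) (s : seq I) (F : I -> 'rV[R]_n -> R) : open U ->
  (forall i, C2_on U (F i)) -> C2_on U (fun y => \sum_(i <- s) F i y).
Proof.
move=> oU C2F; elim: s => [|i s IHs].
  by apply: eq_C2_on (C2_on_cst U 0) => // x _; rewrite big_nil.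
by apply: eq_C2_on (C2_onD oU (C2F i) IHs) => // x _; rewrite big_cons.
Qed.

(** The two claims are proved together because the sum rule for the derivative needs the
    differentiability of the remaining sum. *)
Lemma partial_sum_C1 U (J : Type) (s : seq J) (F : J -> 'rV[R]_n -> R) x i :
  open U -> (forall k, C1_on U (F k)) -> U x ->
  C1_on U (fun y => \sum_(k <- s) F k y) /\
  partial i (fun y => \sum_(k <- s) F k y) x = \sum_(k <- s) partial i (F k) x.
Proof.
move=> oU C1F Ux; elim: s => [|k s [C1s IHs]].
  under eq_fun do rewrite big_nil; rewrite big_nil.
  by split; [exact: C1_on_cst|rewrite partial_cst].
under eq_fun do rewrite big_cons; rewrite big_cons.
split; first exact: C1_onD.
by rewrite partialD ?IHs//; [case: (C1F k _ Ux)|case: (C1s _ Ux)].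
Qed.

Lemma hessian_sum (J : Type) (s : seq J) (F : J -> 'rV[R]_n -> R) x i j :
  (forall k, C2_on setT (F k)) ->
  hessian (fun y => \sum_(k <- s) F k y) x i j = \sum_(k <- s) hessian (F k) x
    i j.
Proof.
move=> C2F; rewrite mxE.
have C1F k : C1_on setT (F k) by case: (C2F k).
have E y : partial j (fun y => \sum_(k <- s) F k y) y =
    \sum_(k <- s) partial j (F k) y.
  have H := proj2 (partial_sum_C1 s j openT C1F (I : setT y)).
  exact: H.
have C1pF k : C1_on setT (partial j (F k)) by case: (C2F k).
have := proj2 (partial_sum_C1 (F := fun k => partial j (F k)) s i openT C1pF (I
  : setT x)).
rewrite -(funext E : partial j _ = _) => ->.
by apply: eq_bigr => k _; rewrite mxE.
Qed.

Lemma hessian_continuous f i j : C2_on setT f ->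
  continuous (fun x => hessian f x i j).
Proof.
move=> [_ C2f] x; rewrite /continuous_at.
under eq_fun do rewrite mxE; rewrite mxE.
by have [_ /(_ i)] := C2f j x I.
Qed.

End C1_C2_calculus.

(** * The Euclidean norm and its balls *)

Section euclidean_norm.
Context {R : realType} {n : nat}.
Implicit Types x y : 'rV[R]_n.

Lemma enorm_ge0 x : 0 <= enorm x.
Proof. exact: sqrtr_ge0. Qed.

Lemma enorm_sqr x : enorm x ^+ 2 = \sum_i x 0 i ^+ 2.
Proof. by rewrite sqr_sqrtr// sumr_ge0// => i _; exact: sqr_ge0. Qed.

Lemma enorm0 : enorm (0 : 'rV[R]_n) = 0.
Proof.
rewrite /enorm big1 ?sqrtr0// => i _.
by rewrite mxE expr0n.
Qed.

Lemma enormN x : enorm (- x) = enorm x.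
Proof. by congr Num.sqrt; apply: eq_bigr => i _; rewrite mxE sqrrN. Qed.

Lemma enormB x y : enorm (x - y) = enorm (y - x).
Proof. by rewrite -enormN opprB. Qed.

Lemma coord_le_enorm x i : `|x 0 i| <= enorm x.
Proof.
rewrite -[leLHS]ger0_norm// -ler_sqr ?nnegrE ?enorm_ge0// enorm_sqr.
rewrite ger0_norm// real_normK ?num_real// (bigD1 i)//= lerDl.
by apply: sumr_ge0 => j _; exact: sqr_ge0.
Qed.

(** The quadratic polynomial |x + t y|^2 in [t] is nonnegative, in particular at its vertex. *)
Lemma cauchy_schwarz x y :
  (\sum_i x 0 i * y 0 i) ^+ 2 <= enorm x ^+ 2 * enorm y ^+ 2.
Proof.
have H t : 0 <= enorm x ^+ 2 + 2 * t * (\sum_i x 0 i * y 0 i) +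
    t ^+ 2 * enorm y ^+ 2.
  rewrite !enorm_sqr !mulr_sumr -!big_split/= sumr_ge0// => i _.
  rewrite (_ : _ + _ = (x 0 i + t * y 0 i) ^+ 2); last by ring.
  exact: sqr_ge0.
set s := \sum_i _ in H *; have [y0|y0] := eqVneq (enorm y ^+ 2) 0.
  rewrite y0 mulr0; have [->|s0] := eqVneq s 0; first by rewrite expr0n.
  (* Without the quadratic term the polynomial is affine, and this [t] would give it the value
     -1. *)
  have := H (- (enorm x ^+ 2 + 1) / (2 * s)).
  rewrite y0 mulr0 addr0 (_ : 2 * _ * s = - (enorm x ^+ 2 + 1)); last by field.
  lra.
have y_gt0 : 0 < enorm y ^+ 2 by rewrite lt_neqAle eq_sym y0 sqr_ge0.
have := H (- s / enorm y ^+ 2).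
set X := enorm x ^+ 2; set Y := enorm y ^+ 2 in y0 y_gt0 *.
rewrite [leRHS](_ : _ = X - s ^+ 2 / Y); last by field.
by rewrite subr_ge0 ler_pdivrMr.
Qed.

Lemma ler_enormD x y : enorm (x + y) <= enorm x + enorm y.
Proof.
rewrite -ler_sqr ?nnegrE ?addr_ge0 ?enorm_ge0// sqrrD enorm_sqr.
rewrite (_ : \sum_i _ = enorm x ^+ 2 + (\sum_i x 0 i * y 0 i) *+ 2 + enorm y ^+
  2).
  rewrite lerD2r lerD2l lerMn2r/= (le_trans (ler_norm _))//.
  rewrite -ler_sqr ?nnegrE ?mulr_ge0 ?enorm_ge0// exprMn.
  by rewrite real_normK ?num_real//; exact: cauchy_schwarz.
rewrite !enorm_sqr -sumrMnl -!big_split/=; apply: eq_bigr => i _.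
by rewrite mxE sqrrD.
Qed.

Lemma enorm_triangle z x y : enorm (x - y) <= enorm (x - z) + enorm (z - y).
Proof. by rewrite (le_trans _ (ler_enormD _ _))// addrA subrK. Qed.

Lemma enorm_le_sum x : enorm x <= \sum_i `|x 0 i|.
Proof.
rewrite -ler_sqr ?nnegrE ?enorm_ge0 ?sumr_ge0// enorm_sqr.
suff : 0 <= \sum_i `|x 0 i| /\ \sum_i x 0 i ^+ 2 <= (\sum_i `|x 0 i|) ^+ 2 by
  case.
elim/big_rec2 : _ => [|i b a _ [b0 ab]]; first by rewrite expr0n.
split; first exact: addr_ge0.
rewrite sqrrD real_normK ?num_real// -addrA lerD2l (le_trans ab)// lerDr.
by rewrite mulrn_wge0// mulr_ge0.
Qed.

Lemma enormZ (a : R) x : enorm (a *: x) = `|a| * enorm x.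
Proof.
rewrite /enorm -sqrtr_sqr -sqrtrM ?sqr_ge0//; congr Num.sqrt.
by rewrite mulr_sumr; apply: eq_bigr => i _; rewrite mxE exprMn.
Qed.

Lemma mx_norm_lt x (e : R) : 0 < e ->
  (`|x| < e) = [forall i, `|x 0 i| < e].
Proof.
move=> e0; rewrite {1}/Num.norm/= mx_normrE.
apply/idP/forallP => [/bigmax_ltP[_ h] i|h].
  exact: (h (0, i)).
by apply/bigmax_ltP; split => // -[i j] _ /=; rewrite (ord1 i).
Qed.

(** The square is a polynomial, hence regular also at [c], where the norm itself is not. Cut-off
    functions are built from it. *)
Lemma enorm_sqr_C2 (c : 'rV[R]_n) : C2_on setT (fun x => enorm (x - c) ^+ 2).
Proof.
have C2c i : C2_on setT (fun x : 'rV[R]_n => (x 0 i - c 0 i) * (x 0 i - c 0 i)).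
  have C2b : C2_on setT (fun x : 'rV[R]_n => x 0 i + - c 0 i).
    apply: C2_onD; [exact: openT|exact: C2_on_coord|exact: C2_on_cst].
  by apply: C2_onM; [exact: openT|exact: C2b|exact: C2b].
apply: eq_C2_on (C2_on_sum (index_enum 'I_n) openT C2c); first exact: openT.
by move=> x _; rewrite enorm_sqr; apply: eq_bigr => i _; rewrite !mxE expr2.
Qed.

Lemma enorm_continuous (c : 'rV[R]_n) : continuous (fun x => enorm (x - c)).
Proof.
move=> x.
rewrite (_ : (fun x => _) = Num.sqrt \o (fun x => enorm (x - c) ^+ 2)).
  apply: continuous_comp; last exact: sqrt_continuous.
  exact: (C1_on_continuous (proj1 (enorm_sqr_C2 c)) (I : setT x)).
by apply/funext => y /=; rewrite sqrtr_sqr ger0_norm ?enorm_ge0.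
Qed.

Lemma open_eball (c : 'rV[R]_n) r : open (eball c r).
Proof.
rewrite (_ : eball c r = (fun x => enorm (x - c)) @^-1` [set t | t < r])//.
by apply: open_comp; [move=> x _; exact: enorm_continuous|exact: open_lt].
Qed.

Definition eball_closed (c : 'rV[R]_n) r := [set x | enorm (x - c) <= r].

Lemma compact_eball_closed (c : 'rV[R]_n) r : compact (eball_closed c r).
Proof.
apply: bounded_closed_compact.
  exists (`|r| + `|c|); split; first by rewrite num_real.
  move=> M rM x /= xr; rewrite ltW//; have M0 : 0 < M.
    by rewrite (le_lt_trans _ rM)// addr_ge0.
  rewrite -(subrK c x) (le_lt_trans (ler_normD _ _))//.
  rewrite -ltrBrDr mx_norm_lt; last first.
    by rewrite subr_gt0 (le_lt_trans _ rM)// lerDr.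
  apply/forallP => i; rewrite (le_lt_trans (coord_le_enorm _ _))//.
  by rewrite (le_lt_trans xr)// (le_lt_trans (ler_norm _))// ltrBrDr.
rewrite (_ : eball_closed c r = (fun x => enorm (x - c)) @^-1` [set t | t <=
  r])//.
apply: closed_comp; last exact: closed_le.
by move=> x _; exact: enorm_continuous.
Qed.

End euclidean_norm.

(** * Borel sets and the measure of boxes *)

Section measure_rV.
Context {R : realType}.

(** Boxes are products of intervals, so the recursively defined measure can be computed on them;
    balls and compact sets are measured through boxes containing them. *)
Definition box n (c : 'rV[R]_n) (e : R) : set 'rV[R]_n :=
  [set y | forall i, `|y 0 i - c 0 i| < e].

Lemma measurable_box n (c : 'rV[R]_n) e : measurable (box c e).
Proof.
rewrite (_ : box c e = \bigcap_(i in [set: 'I_n])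
    (rV_coord i @^-1` [set t | `|t - c 0 i| < e])).
  apply: fin_bigcap_measurable => // i _; rewrite -[X in measurable X]setTI.
  apply: measurable_rV_coord => //.
  rewrite (_ : [set t | _] = ball (c 0 i) e);
    first exact: measurable_realfun.measurable_ball.
  by apply/seteqP; split => t /=; rewrite /ball/= distrC.
by apply/seteqP; split => y /= h i; [move=> _|]; exact: h.
Qed.

(** The measurable structure is generated by the coordinates, so an open set is written as the union
    of the countably many boxes with rational centre and radius 1/(k+1) that it contains. *)
Lemma measurable_open_rV n (U : set 'rV[R]_n) : open U -> measurable U.
Proof.
move=> oU.
pose D := [set q : 'rV[rat]_n * nat | box (map_mx ratr q.1) q.2.+1%:R^-1 `<=` U].
rewrite (_ : U = \bigcup_(q in D) box (map_mx ratr q.1) q.2.+1%:R^-1).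
  rewrite bigcup_mkcond; apply: countable_bigcupT_measurable => // q.
  by case: ifPn => _; [exact: measurable_box|exact: measurable0].
apply/seteqP; split => [x Ux|x [q Dq]]; last exact: Dq.
have /nbhs_ballP[e /= e0 eU] : nbhs x U by exact: open_nbhs_nbhs.
(* One half of [e] is for the distance from [x] to a rational centre, the other for the box
   itself. *)
have [k /= ke] : exists k : nat, k.+1%:R^-1 < e / 2.
  by have [k _ /(_ k (leqnn k))] := near_infty_natSinv_lt (PosNum (divr_gt0 e0
    (ltr0Sn _ 1))); exists k.
have k0 : (0 : R) < k.+1%:R^-1 by rewrite invr_gt0.
have /choice[c cP] : forall i : 'I_n, exists q : rat,
    `|x 0 i - ratr q| < k.+1%:R^-1.
  move=> i; have [|q] := @rat_in_itvoo R (x 0 i - k.+1%:R^-1) (x 0 i +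
    k.+1%:R^-1).
    by rewrite ltrD2l gtrN.
  by rewrite in_itv/= => qx; exists q; rewrite distrC ltr_distl.
exists (\row_i c i, k) => /=; last by move=> i; rewrite !mxE.
move=> y ye; apply: eU; rewrite mx_norm_ball /ball_/= mx_norm_lt//.
apply/forallP => i; rewrite !mxE; have := ye i; rewrite !mxE => yi.
rewrite (le_lt_trans (ler_distD (ratr (c i)) _ _))// [ltRHS]splitr.
by rewrite ltrD// (lt_trans _ ke)// distrC.
Qed.

Lemma measurable_compact_rV n (K : set 'rV[R]_n) : compact K -> measurable K.
Proof.
move=> /compact_closed cK; rewrite -(setCK K); apply: measurableC.
by apply: measurable_open_rV; apply: closed_openC; apply: cK;
  exact: norm_hausdorff.
Qed.

Lemma continuous_measurable_rV n (f : 'rV[R]_n -> R) :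
  continuous f -> measurable_fun setT f.
Proof.
move=> cf; apply: (measurability _ (measurable_realfun.RGenOInfty.measurableE R)).
move=> _ [_ [a ->] <-]; rewrite setTI; apply: measurable_open_rV.
by apply: open_comp; [move=> x _; exact: cf|exact: interval_open].
Qed.

(** Induction on the dimension: the preimage of a box under [rV_join] is a box times an interval. In
    dimension 0 the measure is a Dirac mass and both sides are 1. *)
Lemma lebesgue_box n (c : 'rV[R]_n) e : 0 <= e ->
  lebesgue_rV R n (box c e) = ((2 * e) ^+ n)%:E.
Proof.
move=> e0; elim: n c => [|n IHn] c.
  rewrite expr0 /= diracE mem_set//; by move=> [].
rewrite /= /lebesgue_rV_succ /pushforward.
rewrite (_ : _ @^-1` _ = box (rV_split c).1 e `*` ball ((rV_split c).2 : R) e).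
  rewrite product_measure1E ?IHn//;
    [|exact: measurable_box|exact: measurable_realfun.measurable_ball].
  transitivity (((2 * e) ^+ n)%:E * (e *+ 2)%:E)%E.
    by congr (_ * _)%E; [exact: IHn|exact: lebesgue_measure_ball].
  by rewrite -EFinM exprSr mulr_natl.
apply/seteqP; split => -[y t] /=.
  move=> h; split => [i|].
    by have := h (lift ord_max i); rewrite !mxE liftK.
  by have := h ord_max; rewrite !mxE unlift_none /ball/= distrC.
move=> [h1 h2] i; rewrite mxE; case: (unliftP ord_max i) => [j ->|->].
  by have := h1 j; rewrite !mxE.
by move: h2; rewrite /ball/= distrC.
Qed.

Lemma eball_sub_box n (c : 'rV[R]_n) e : eball c e `<=` box c e.
Proof.
move=> x; rewrite /eball/= => xe i; rewrite (le_lt_trans _ xe)//.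
by have := coord_le_enorm (x - c) i; rewrite !mxE.
Qed.

Lemma compact_sub_box n (K : set 'rV[R]_n) : compact K ->
  exists2 M, 0 <= M & K `<=` box 0 M.
Proof.
move=> /compact_bounded[M [_ KM]]; exists (`|M| + 2); first by rewrite addr_ge0.
move=> x Kx.
have M1 : M < `|M| + 1 by rewrite (le_lt_trans (ler_norm M))// ltrDl.
have xM : `|x| < `|M| + 2 by rewrite (le_lt_trans (KM _ M1 _ Kx))// ltrD2l ltr1n.
move: xM; rewrite mx_norm_lt; last by rewrite ltr_wpDl.
by move=> /forallP h i; rewrite mxE subr0.
Qed.

Lemma lebesgue_compact_fin n (K : set 'rV[R]_n) : compact K ->
  (lebesgue_rV R n K < +oo)%E.
Proof.
move=> cK; have [M M0 KM] := compact_sub_box cK.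
apply: (@le_lt_trans _ _ (lebesgue_rV R n (box 0 M))).
  apply: le_measure; rewrite ?inE//; first exact: measurable_compact_rV.
  exact: measurable_box.
by rewrite lebesgue_box// ltry.
Qed.

End measure_rV.

(** * Continuous functions on compact sets *)

Section continuous_compact_support.
Context {R : realType} {n : nat}.
Implicit Types (f g : 'rV[R]_n -> R) (K : set 'rV[R]_n).

Lemma continuous_compact_bounded f K : continuous f -> compact K ->
  exists2 M, 0 <= M & forall x, K x -> `|f x| <= M.
Proof.
move=> cf cK.
have /compact_bounded[M [_ KM]] : compact (f @` K).
  by apply: continuous_compact => //; exact: continuous_subspaceT.
exists (`|M| + 1); first by rewrite addr_ge0.
move=> x Kx; apply: (KM (`|M| + 1)); first by rewrite ltr_pwDr ?ler_norm.
by exists x.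
Qed.

Lemma continuous_integrable_compact f K : continuous f -> compact K ->
  (lebesgue_rV R n).-integrable K (EFin \o f).
Proof.
move=> cf cK; apply: measurable_bounded_integrable.
- exact: measurable_compact_rV.
- exact: lebesgue_compact_fin.
- by apply: measurable_funTS; exact: continuous_measurable_rV.
- have [M M0 KM] := continuous_compact_bounded cf cK.
  exists M; split; first by rewrite num_real.
  by move=> N MN x Kx /=; rewrite (le_trans (KM _ Kx))// ltW.
Qed.

End continuous_compact_support.

(** * Integrals of partial derivatives *)

(** A directional derivative only sees the function along a line. The two spaces may differ, so that
    a partial derivative in dimension n + 1 can be identified with a derivative of a slice in
    dimension n or 1. *)
Lemma eq_derive_line {R : numFieldType} {V V' W : normedModType R}
    (f : V -> W) (g : V' -> W) a v a' v' :
  (forall h : R, f (h *: v + a) = g (h *: v' + a')) ->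
  'D_v f a = 'D_v' g a' /\ (derivable f a v -> derivable g a' v').
Proof.
move=> fg; have fga : f a = g a' by have := fg 0; rewrite !scale0r !add0r.
have E : (fun h : R => h^-1 *: ((f \o shift a) (h *: v) - f a)) =
         (fun h : R => h^-1 *: ((g \o shift a') (h *: v') - g a')).
  by apply/funext => h /=; rewrite fg fga.
by rewrite /derive /derivable E.
Qed.

Section divergence.
Context {R : realType}.

Lemma cvg_rV_join_l n (t : R) : continuous (fun y : 'rV[R]_n => rV_join (y, t)).
Proof.
move=> y; apply/(@cvgrPdist_lt _ _ _ (nbhs y)) => e e0.
apply/nbhs_ballP; exists e => //= y'; rewrite mx_norm_ball /ball_/= => yy'.
rewrite mx_norm_lt//; apply/forallP => i; rewrite !mxE.
case: (unliftP ord_max i) => [j _|_] /=; last by rewrite subrr normr0.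
by move: yy'; rewrite mx_norm_lt// => /forallP/(_ j); rewrite !mxE.
Qed.

Lemma cvg_rV_join_r n (y : 'rV[R]_n) : continuous (fun t : R => rV_join (y, t)).
Proof.
move=> t; apply/cvgrPdist_lt => e e0.
apply/nbhs_ballP; exists e => //= t'; rewrite /ball/= => tt'.
rewrite mx_norm_lt//; apply/forallP => i; rewrite !mxE.
by case: (unliftP ord_max i) => [j _|_] //=; rewrite subrr normr0.
Qed.

Lemma rV_join_shift_l n (y : 'rV[R]_n) (t h : R) j :
  rV_join (h *: delta_mx 0 j + y, t) =
  h *: delta_mx 0 (lift ord_max j) + rV_join (y, t).
Proof.
apply/rowP => i; rewrite !mxE.
case: (unliftP ord_max i) => [k ->|->] /=; rewrite ?mxE ?eqxx/=.
  by rewrite (inj_eq lift_inj).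
by rewrite (negbTE (neq_lift _ _)) mulr0 add0r.
Qed.

Lemma rV_join_shift_r n (y : 'rV[R]_n) (t h : R) :
  rV_join (y, h + t) = h *: delta_mx 0 ord_max + rV_join (y, t).
Proof.
apply/rowP => i; rewrite !mxE.
case: (unliftP ord_max i) => [k ->|->] /=; last by rewrite !eqxx mulr1.
by rewrite [lift _ _ == _]eq_sym (negbTE (neq_lift _ _)) mulr0 add0r.
Qed.

(* Only coordinatewise differentiability is required, so that the property is
   inherited by the slices of the function. *)
Definition vanishing_partial n (f : 'rV[R]_n -> R) (i : 'I_n) (M : R) : Prop :=
  [/\ forall x, derivable f x (delta_mx 0 i), continuous (partial i f) &
      forall x, ~ box 0 M x -> f x = 0 /\ partial i f x = 0].

Lemma box_sub_compact n (M : R) :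
  exists2 K : set 'rV[R]_n, compact K & box 0 M `<=` K.
Proof.
exists (eball_closed 0 (\sum_(i < n) `|M|)); first exact: compact_eball_closed.
move=> x xM; rewrite /eball_closed/= (le_trans (enorm_le_sum _))//.
apply: ler_sum => i _; have := xM i; rewrite !mxE => /ltW/le_trans; apply.
exact: ler_norm.
Qed.

Lemma integrable_vanishing n (g : 'rV[R]_n -> R) M : continuous g ->
  (forall x, ~ box 0 M x -> g x = 0) ->
  (lebesgue_rV R n).-integrable setT (EFin \o g).
Proof.
move=> cg g0; have [K cK bK] := @box_sub_compact n M.
have /(integrable_mkcond _ (measurable_compact_rV cK)) :=
  continuous_integrable_compact cg cK.
apply: eq_integrable => // x _; rewrite /patch; case: ifPn => //= xK.
by rewrite g0// => /bK xK'; rewrite mem_set in xK.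
Qed.

Lemma integral_lebesgue_rV_succ n (g : 'rV[R]_n.+1 -> \bar R) :
  measurable_fun setT g ->
  ((lebesgue_rV R n) \x (@lebesgue_measure R))%E.-integrable setT
    (g \o @rV_join R n) ->
  (\int[lebesgue_rV R n.+1]_x g x =
   \int[(lebesgue_rV R n) \x (@lebesgue_measure R)]_z g (rV_join z))%E.
Proof.
move=> mg ig.
by rewrite -[RHS](integral_pushforward (@measurable_rV_join R n) mg ig
  measurableT).
Qed.

Lemma integrable_lebesgue_rV_succ n (g : 'rV[R]_n.+1 -> \bar R) :
  (lebesgue_rV R n.+1).-integrable setT g ->
  ((lebesgue_rV R n) \x (@lebesgue_measure R))%E.-integrable setT
    (g \o @rV_join R n).
Proof.
move=> /integrableP[mg ig]; apply/integrableP; split.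
  by apply: (measurableT_comp mg); exact: measurable_rV_join.
apply: le_lt_trans ig.
have mag : measurable_fun setT (abse \o g) by exact: measurableT_comp.
rewrite -[leLHS](ge0_integral_pushforward (@measurable_rV_join R n) _
  measurableT mag).
  exact: lexx.
by move=> y _ /=.
Qed.

(** Fubini and induction on the dimension. For one of the first directions the last coordinate is
    frozen and the induction hypothesis applies to the slice; for the last direction the others are
    frozen and the fundamental theorem of calculus applies. *)
Lemma integral_partial_eq0 n (f : 'rV[R]_n -> R) (i : 'I_n) (M : R) :
  vanishing_partial f i M ->
  (\int[lebesgue_rV R n]_x (partial i f x)%:E = 0)%E.
Proof.
elim: n f i => [|n IHn] f i [df cf f0]; first by case: i df cf f0.
have ip : (lebesgue_rV R n.+1).-integrable setT (EFin \o partial i f).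
  by apply: (@integrable_vanishing _ _ M) => // x /f0[].
have mp : measurable_fun setT (EFin \o partial i f) by exact: measurable_int ip.
have ipj := integrable_lebesgue_rV_succ ip.
rewrite (integral_lebesgue_rV_succ mp ipj) => {mp ip}.
case: (unliftP ord_max i) => [j ij|ij].
- rewrite -(integral21_prod_meas1 ipj) integral0_eq// => t _.
  rewrite /fubini_G /=; pose h y := f (rV_join (y, t)).
  have fh y : forall a : R, f (a *: delta_mx 0 i + rV_join (y, t)) =
                            h (a *: delta_mx 0 j + y).
    by move=> a; rewrite ij -rV_join_shift_l.
  have hE y : partial i f (rV_join (y, t)) = partial j h y.
    by have [] := eq_derive_line (fh y).
  under eq_integral do rewrite hE; apply: IHn; split.
  + by move=> y; have [_] := eq_derive_line (fh y); apply.
  + rewrite -(funext hE) => y.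
    by apply: continuous_comp; [exact: cvg_rV_join_l|exact: cf].
  + move=> y yM; rewrite -hE; apply: f0 => jM; apply: yM => k.
    by have := jM (lift ord_max k); rewrite !mxE liftK.
- rewrite -(integral12_prod_meas1 ipj) integral0_eq// => y _.
  rewrite /fubini_F /=; pose h t := f (rV_join (y, t)).
  have fh t : forall a : R, f (a *: delta_mx 0 i + rV_join (y, t)) =
                            h (a *: 1 + t).
    by move=> a; rewrite ij -rV_join_shift_r /h [_%:A]mulr1.
  have hE t : partial i f (rV_join (y, t)) = h^`()%classic t.
    by rewrite derive1E; have [] := eq_derive_line (fh t).
  have dh t : derivable h t 1.
    by have [_] := eq_derive_line (fh t); apply.
  have ch : continuous h.
    by move=> t; apply: differentiable_continuous; apply/derivable1_diffP.
  have cdh : continuous (fun t => partial i f (rV_join (y, t))).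
    by move=> t; apply: continuous_comp; [exact: cvg_rV_join_r|exact: cf].
  have h0 t : `|M| + 1 <= `|t| -> h t = 0 /\ partial i f (rV_join (y, t)) = 0.
    move=> tM; apply: f0 => jM; have := jM ord_max.
    rewrite !mxE unlift_none /= subr0; apply/negP; rewrite -leNgt.
    by rewrite (le_trans _ tM)// (le_trans (ler_norm _))// lerDl.
  (* The summand 1 makes the interval nondegenerate whatever [M] is. *)
  set N := `|M| + 1 in h0 *; have N0 : 0 < N by rewrite ltr_wpDl.
  transitivity (\int[lebesgue_measure]_(t in `[(- N)%R,
    N]) (partial i f (rV_join (y, t)))%:E)%E.
    rewrite [RHS]integral_mkcond; apply: eq_integral => t _.
    rewrite /patch; case: ifPn => // /negP tN; rewrite (proj2 (h0 t _))//.
    rewrite leNgt; apply/negP; rewrite ltr_norml => /andP[a b]; apply: tN.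
    by rewrite inE/= in_itv/= !ltW.
  rewrite (@continuous_FTC2 _ _ h).
  + by rewrite (proj1 (h0 N _)) ?(proj1 (h0 (- N) _)) ?normrN ?gtr0_norm// subee.
  + by rewrite gtrN.
  + exact: continuous_subspaceT.
  + split; first by move=> t _; exact: dh.
      by apply: cvg_at_right_filter; exact: ch.
    by apply: cvg_at_left_filter; exact: ch.
  + by move=> t _; rewrite hE.
Qed.

End divergence.

(** * Integration against compactly supported functions *)

Section compact_support.
Context {R : realType} {n : nat}.
Implicit Types (f g u : 'rV[R]_n -> R) (K U : set 'rV[R]_n).
Local Notation mu := (lebesgue_rV R n).

Lemma closed_compact_rV K : compact K -> closed K.
Proof. by move/compact_closed; apply; exact: norm_hausdorff. Qed.

Lemma partial_off_support f K i : compact K -> (forall x, ~ K x -> f x = 0) ->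
  forall x, ~ K x -> partial i f x = 0.
Proof.
move=> cK f0 x Kx; rewrite -(partial_cst 0 x i).
apply: (@partial_eq_on _ _ (~` K)) => //.
by apply: closed_openC; exact: closed_compact_rV.
Qed.

Lemma Rintegral_support U g : (forall x, ~ U x -> g x = 0) ->
  \int[mu]_(x in U) g x = \int[mu]_x g x.
Proof.
move=> g0; rewrite Rintegral_mkcond; apply: eq_Rintegral => x _.
by rewrite /patch; case: ifPn => // /negP xU; rewrite g0// => /mem_set.
Qed.

(** Weak derivatives are tested on [U], whereas integration by parts is available on the whole
    space; the support of the test function allows passing from one to the other. *)
Lemma RintegralM_support U K f g : K `<=` U -> (forall x, ~ K x -> g x = 0) ->
  \int[mu]_(x in U) (f x * g x) = \int[mu]_x (f x * g x).
Proof.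
move=> KU g0; apply: Rintegral_support => x Ux.
by rewrite g0 ?mulr0// => /KU.
Qed.

Lemma integral_partial_C1 f K i : C1_on setT f -> compact K ->
  (forall x, ~ K x -> f x = 0) -> \int[mu]_x partial i f x = 0.
Proof.
move=> C1f cK f0; have [M _ KM] := compact_sub_box cK.
rewrite /Rintegral (@integral_partial_eq0 _ _ f i M)//; split.
- by move=> x; apply: diff_derivable; case: (C1f x I).
- exact: C1_partial_continuous.
- move=> x xM; have Kx : ~ K x by move/KM.
  by rewrite f0// (partial_off_support _ cK f0).
Qed.

Lemma Lp_on1_integrable K u : compact K ->
  Lp_on 1 K u <-> mu.-integrable K (EFin \o u).
Proof.
move=> cK; rewrite /Lp_on; apply: iff_trans (Lfun1_integrable _ _) _.
rewrite (integrable_mkcond _ (measurable_compact_rV cK)).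
rewrite (_ : EFin \o (u \_ K) = (EFin \o u) \_ K)//.
by apply/funext => x; rewrite /= /patch; case: ifP.
Qed.

Lemma integrableM_support u g K : mu.-integrable K (EFin \o u) ->
  compact K -> continuous g -> (forall x, ~ K x -> g x = 0) ->
  mu.-integrable setT (EFin \o (fun x => u x * g x)).
Proof.
move=> iu cK cg g0; have mK := measurable_compact_rV cK.
have [M M0 gM] := continuous_compact_bounded cg cK.
have : mu.-integrable K ((EFin \o u) \* (EFin \o g))%E.
  apply: integrableMl => //.
    by apply: measurable_funTS; exact: continuous_measurable_rV.
  exists M; split; first by rewrite num_real.
  by move=> N MN x Kx /=; rewrite (le_trans (gM _ Kx))// ltW.
move=> /(integrable_mkcond _ mK); apply: eq_integrable => // x _.
rewrite /patch; case: ifPn => //= /negP xK.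
by rewrite g0 ?mulr0// => /mem_set.
Qed.

Lemma Lp_loc1_integrableM U u g K : Lp_loc 1 U u -> K `<=` U ->
  compact K -> continuous g -> (forall x, ~ K x -> g x = 0) ->
  mu.-integrable setT (EFin \o (fun x => u x * g x)).
Proof.
move=> lu KU cK cg g0; apply: (@integrableM_support _ _ K) => //.
by apply/Lp_on1_integrable => //; exact: lu.
Qed.

End compact_support.

(** * Affine functions and weak derivatives *)

Section affine.
Context {R : realType} {n : nat}.
Implicit Types (f g u phi psi : 'rV[R]_n -> R) (K U : set 'rV[R]_n)
  (a : R) (b : 'rV[R]_n).
Local Notation mu := (lebesgue_rV R n).

Definition affine a b (x : 'rV[R]_n) : R := a + \sum_i b 0 i * x 0 i.

Lemma affine_C2 U a b : open U -> C2_on U (affine a b).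
Proof.
move=> oU; have C2i i : C2_on U (fun x : 'rV[R]_n => b 0 i * x 0 i).
  by apply: C2_onM => //; [exact: C2_on_cst|exact: C2_on_coord].
have := C2_onD oU (C2_on_cst U a) (C2_on_sum (index_enum 'I_n) oU C2i).
exact: eq_C2_on.
Qed.

Lemma affine_C1 U a b : open U -> C1_on U (affine a b).
Proof. by move=> /(affine_C2 a b)[]. Qed.

Lemma affine_differentiable a b x : differentiable (affine a b) x.
Proof. by have [] := @affine_C1 setT a b openT x I. Qed.

Lemma affine_continuous a b : continuous (affine a b).
Proof. by move=> x; exact: differentiable_continuous (affine_differentiable _ _
  _). Qed.

Lemma partial_affine a b i x : partial i (affine a b) x = b 0 i.
Proof.
pose F j (x : 'rV[R]_n) := b 0 j * x 0 j.
have C1F j : C1_on setT (F j).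
  by apply: C1_onM; [exact: openT|exact: C1_on_cst|exact: C1_on_coord].
have [C1s pE] := partial_sum_C1 (index_enum 'I_n) i openT C1F (I : setT x).
have -> : affine a b = (fun y => cst a y + \sum_(j <- index_enum 'I_n) F j y)
  by [].
rewrite partialD//; last by case: (C1s x I).
rewrite partial_cst pE add0r (bigD1 i)//= big1 ?addr0.
  rewrite /F partialM//; last exact: differentiable_coord.
  by rewrite partial_cst mul0r add0r partial_coord eqxx mulr1.
move=> j ji; rewrite /F partialM//; last exact: differentiable_coord.
by rewrite partial_cst mul0r add0r partial_coord eq_sym (negbTE ji) mulr0.
Qed.

Lemma hessian_affine U phi a b x : open U -> C2_on U phi -> U x ->
  hessian (fun y => phi y + affine a b y) x = hessian phi x.
Proof.
move=> oU [C1p C2p] Ux; apply/matrixP => i j; rewrite [LHS]mxE [RHS]mxE.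
transitivity (partial i (fun y => partial j phi y + cst (b 0 j) y) x).
  apply: (@partial_eq_on _ _ U) => // y Uy; rewrite partialD.
  - by rewrite partial_affine.
  - by case: (C1p y Uy).
  - exact: affine_differentiable.
by rewrite partialD ?partial_cst ?addr0//; case: (C2p j x Ux).
Qed.

(** By the product rule the two integrands are, up to sign, the parts of a partial derivative of the
    product [affine a b x * psi x], which has integral 0. *)
Lemma integral_affine_partial a b psi K i : C1_on setT psi -> compact K ->
  (forall x, ~ K x -> psi x = 0) ->
  \int[mu]_x (affine a b x * partial i psi x) =
  - \int[mu]_x (b 0 i * psi x).
Proof.
move=> C1p cK p0; have p0' := partial_off_support i cK p0.
have cp x : {for x, continuous psi} by exact: C1_on_continuous C1p _.
have cpi := @C1_partial_continuous _ _ psi i C1p.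
have il : mu.-integrable setT (EFin \o (fun x => affine a b x * partial i psi x)).
  apply: (@integrableM_support _ _ _ _ K) => //.
  by apply: continuous_integrable_compact => //; exact: affine_continuous.
have ib : mu.-integrable setT (EFin \o (fun x => b 0 i * psi x)).
  apply: (@integrableM_support _ _ (cst (b 0 i)) _ K) => //.
  by apply: continuous_integrable_compact => //; exact: cst_continuous.
apply/eqP; rewrite -addr_eq0 -RintegralD//; apply/eqP.
have C1lp := C1_onM openT (affine_C1 a b openT) C1p.
rewrite -[RHS](integral_partial_C1 i C1lp cK) => [|x Kx];
  last by rewrite p0// mulr0.
apply: eq_Rintegral => x _.
rewrite partialM ?partial_affine;
  [|exact: affine_differentiable|by case: (C1p x I)].
by rewrite addrC.
Qed.

(** One integration by parts leaves the constant [b 0 i] times a partial derivative of [psi], which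
    integrates to 0. *)
Lemma integral_affine_hessian a b psi K i j : C2_on setT psi -> compact K ->
  (forall x, ~ K x -> psi x = 0) ->
  \int[mu]_x (affine a b x * hessian psi x i j) = 0.
Proof.
move=> [C1p C2p] cK p0; have p0' := partial_off_support j cK p0.
under eq_Rintegral do rewrite mxE.
rewrite (integral_affine_partial _ _ _ (C2p j) cK p0').
rewrite RintegralZl//; last first.
  have cpj := @C1_partial_continuous _ _ psi j C1p.
  have [M _ KM] := compact_sub_box cK;
    apply: (@integrable_vanishing _ _ _ M) => //.
  by move=> x xM; apply: p0' => /KM.
by rewrite (integral_partial_C1 j C1p cK p0) mulr0 oppr0.
Qed.

Lemma Lp_on_bounded p K g : 1 <= p -> compact K -> continuous g -> Lp_on p%:E K g.
Proof.
move=> p1 cK cg; have mK := measurable_compact_rV cK.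
have [M M0 gM] := continuous_compact_bounded cg cK.
have mg : measurable_fun setT (g \_ K).
  apply/(measurable_restrictT _ mK).
  by apply: measurable_funTS; exact: continuous_measurable_rV.
rewrite /Lp_on inE; apply/andP; split; rewrite inE//= /finite_norm.
rewrite unlock /Lnorm; apply: poweR_lty.
apply: (@le_lt_trans _ _ (\int[mu]_(x in K) (M `^ p)%:E)%E).
  rewrite [leRHS]integral_mkcond; apply: ge0_le_integral => //.
  - by move=> x _; exact: poweR_ge0.
  - apply: (@measurableT_comp _ _ _ _ _ _ (fun x => x `^ p)%E) => //=.
      exact: measurable_poweR.
    by do 2 apply: measurableT_comp => //.
  - by apply/(measurable_restrictT _ mK).
  - move=> x _ /=; rewrite /patch; case: ifPn => [|_].
      by rewrite inE => Kx; rewrite lee_fin ge0_ler_powR ?nnegrE//;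
        [lra|exact: gM].
    by rewrite normr0 /= powR0//; lra.
rewrite integral_cst// lte_mul_pinfty//; first by rewrite lee_fin powR_ge0.
exact: lebesgue_compact_fin.
Qed.

Lemma Lp_onD p K f g : 1 <= p -> Lp_on p%:E K f -> Lp_on p%:E K g ->
  Lp_on p%:E K (fun x => f x + g x).
Proof.
move=> p1 lf lg; rewrite /Lp_on.
rewrite (_ : _ \_ _ = f \_ K + g \_ K); last first.
  by apply/funext => x; rewrite /patch fctE; case: ifP => //; rewrite addr0.
have p1' : (1 <= p%:E)%E by rewrite lee_fin.
by apply: (proj2 (Lfun_addr_closed mu p1')).
Qed.

Lemma Lp_loc_affine p U u a b : 1 <= p -> Lp_loc p%:E U u ->
  Lp_loc p%:E U (fun x => u x + affine a b x).
Proof.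
move=> p1 lu K cK KU; apply: Lp_onD => //; first exact: lu.
by apply: Lp_on_bounded => //; exact: affine_continuous.
Qed.

Lemma weak_hessian_affine U u H a b : weak_hessian U u H ->
  weak_hessian U (fun x => u x + affine a b x) H.
Proof.
move=> [lu lH uH]; split => //; first exact: Lp_loc_affine.
move=> psi psiC i j; rewrite -uH//.
have [C2p [K [cK KU p0]]] := psiC.
have h0 x : ~ K x -> hessian psi x i j = 0.
  move=> Kx; rewrite mxE; apply: (partial_off_support _ cK) Kx.
  exact: partial_off_support.
have ch := @hessian_continuous _ _ psi i j C2p.
rewrite !(@RintegralM_support _ _ U K _ _ KU h0).
rewrite -[RHS]addr0 -[X in _ = _ + X](integral_affine_hessian a b i j C2p cK p0).
rewrite -RintegralD//.
- by apply: eq_Rintegral => x _; rewrite mulrDl.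
- exact: (Lp_loc1_integrableM lu KU cK ch h0).
- apply: (Lp_loc1_integrableM _ KU cK ch h0) => K' cK' _.
  by apply: Lp_on_bounded => //; exact: affine_continuous.
Qed.

Lemma weak_gradient_affine U u G a b : weak_gradient U u G ->
  weak_gradient U (fun x => u x + affine a b x) (fun x => G x + b).
Proof.
have lb i : Lp_loc 1 U (fun x : 'rV[R]_n => b 0 i).
  by move=> K cK _; apply: (@Lp_on_bounded 1) => //; exact: cst_continuous.
move=> [lu lG uG]; split => [|i|]; first exact: Lp_loc_affine.
  move=> K cK KU; under eq_fun do rewrite mxE.
  by apply: (@Lp_onD 1) => //; [exact: lG|exact: lb].
move=> psi psiC i; have [C1p [K [cK KU p0]]] := psiC.
have h0 := partial_off_support i cK p0.
have ch := @C1_partial_continuous _ _ psi i C1p.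
have cp : continuous psi by move=> x; exact: C1_on_continuous C1p _.
have := uG _ psiC i.
rewrite !(@RintegralM_support _ _ U K _ _ KU h0) !(@RintegralM_support _ _ U K
  _ _ KU p0).
move=> uGi.
under eq_Rintegral do rewrite mulrDl.
rewrite RintegralD//; last 2 first.
- exact: (Lp_loc1_integrableM lu KU cK ch h0).
- apply: (Lp_loc1_integrableM _ KU cK ch h0) => K' cK' _.
  by apply: Lp_on_bounded => //; exact: affine_continuous.
rewrite uGi (integral_affine_partial a b i C1p cK p0) -opprD -RintegralD//.
- by congr (- _); apply: eq_Rintegral => x _; rewrite mxE mulrDl.
- exact: (Lp_loc1_integrableM (lG i) KU cK cp p0).
- exact: (Lp_loc1_integrableM (lb i) KU cK cp p0).
Qed.

Lemma W2p_loc_affine p U u H a b : 1 <= p -> W2p_loc p%:E U u H ->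
  W2p_loc p%:E U (fun x => u x + affine a b x) H.
Proof.
move=> p1 [lu [G uG lG] uH lH]; split => //.
- exact: Lp_loc_affine.
- exists (fun x => G x + b); first exact: weak_gradient_affine.
  move=> i K cK KU; under eq_fun do rewrite mxE.
  by apply: Lp_onD => //; [exact: lG|apply: Lp_on_bounded => //;
    exact: cst_continuous].
- exact: weak_hessian_affine.
Qed.

End affine.

(** * Adding an affine function to a solution *)

Section solution_affine.
Context {R : realType} {n : nat}.

(** For strong solutions the same Hessian serves. In both viscosity senses the affine function is
    moved to the other side, onto the test function, whose Hessian it does not change. *)
Lemma solution_affine s (p : R) (U : set 'rV[R]_n) F f u a b :
  1 <= p -> open U -> solution s p U F f u ->
  solution s p U F f (fun x => u x + affine a b x).
Proof.
have cD (g : 'rV[R]_n -> R) c d x :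
    {for x, continuous g} -> {for x, continuous (fun y => g y + affine c d y)}.
  by move=> cg; apply: continuousD cg _; exact: affine_continuous.
have aN x : affine a b x + affine (- a) (- b) x = 0.
  rewrite /affine addrACA subrr add0r -big_split big1//= => i _.
  by rewrite mxE mulNr subrr.
pose sub g (x : 'rV[R]_n) := g x + affine (- a) (- b) x.
have uE g (x y : 'rV[R]_n) :
    (u y + affine a b y - g y <= u x + affine a b x - g x) =
    (u y - sub g y <= u x - sub g x).
  have key (A : 'rV[R]_n -> R) : (u y + A y - g y <= u x + A x - g x) =
      (u y - (g y - A y) <= u x - (g x - A x)) by rewrite !opprB !addrA.
  have aE z : affine (- a) (- b) z = - affine a b z.
    by apply/eqP; rewrite -addr_eq0 addrC aN.
  by rewrite /sub !aE key.
have uE' g (x y : 'rV[R]_n) :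
    (u x + affine a b x - g x <= u y + affine a b y - g y) =
    (u x - sub g x <= u y - sub g y) by exact: uE.
move=> p1 oU; case: s => /=.
- by move=> [H uH FH]; exists H => //; exact: W2p_loc_affine.
- move=> [cu sub1 sup1]; split.
  + by move=> x Ux; apply: cD; exact: cu.
  + move=> phi x C2p Ux hx; rewrite -(hessian_affine (- a) (- b) oU C2p Ux).
    apply: (sub1 (sub phi) x _ Ux).
      exact: (C2_onD oU C2p (affine_C2 _ _ oU)).
    by apply: filterS hx => y; rewrite uE.
  + move=> phi x C2p Ux hx; rewrite -(hessian_affine (- a) (- b) oU C2p Ux).
    apply: (sup1 (sub phi) x _ Ux).
      exact: (C2_onD oU C2p (affine_C2 _ _ oU)).
    by apply: filterS hx => y; rewrite uE'.
- move=> [cu sub1 sup1]; split.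
  + by move=> x Ux; apply: cD; exact: cu.
  + move=> phi H cp pH eps O e0 oO OU FH x Ox hx.
    apply: (sub1 (sub phi) H _ _ eps O e0 oO OU FH x Ox).
    * by move=> y Uy; apply: cD; exact: cp.
    * exact: W2p_loc_affine.
    * by apply: filterS hx => y; rewrite uE.
  + move=> phi H cp pH eps O e0 oO OU FH x Ox hx.
    apply: (sup1 (sub phi) H _ _ eps O e0 oO OU FH x Ox).
    * by move=> y Uy; apply: cD; exact: cp.
    * exact: W2p_loc_affine.
    * by apply: filterS hx => y; rewrite uE'.
Qed.

End solution_affine.

(** * Cut-off functions of class C2 *)

Section cutoff.
Context {R : realType}.

(** Weak Hessians are tested against C2 functions, so cut-offs can be made from the cube of the
    positive part, which is C2 with second derivative 6 max(t, 0). *)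
Definition pospow (k : nat) (t : R) : R := Num.max t 0 ^+ k.

Lemma pospow_ge0 k t : 0 <= pospow k t.
Proof. by rewrite exprn_ge0// le_max lexx orbT. Qed.

Lemma pospow_neg k t : t <= 0 -> pospow k.+1 t = 0.
Proof. by move=> t0; rewrite /pospow (max_idPr t0) expr0n. Qed.

Lemma pospow_continuous k : continuous (pospow k).
Proof.
move=> t; rewrite /pospow.
apply: (@continuous_comp _ _ _ (fun t : R => Num.max t 0) (fun s => s ^+ k)).
  by apply: continuous_max; [exact: cvg_id|exact: cst_continuous].
exact: exprn_continuous.
Qed.

Lemma pospow_is_derive k (t : R) :
  is_derive t 1 (pospow k.+2) (k.+2%:R * pospow k.+1 t).
Proof.
have [t0|t0|->] := ltgtP t 0.
- rewrite pospow_neg ?ltW// mulr0.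
  apply: (@near_eq_is_derive _ _ _ (cst 0)).
    near=> s; rewrite pospow_neg// ltW//; near: s; exact: lt_nbhsl.
- have e : is_derive t 1 (@GRing.exp R ^~ k.+2) (k.+2%:R * t ^+ k.+1).
    by apply: DeriveDef; [exact: exprn_derivable|rewrite exp_derive [LHS]mulr1].
  rewrite {2}/pospow (max_l (ltW t0)); apply: near_eq_is_derive e.
  near=> s; rewrite /pospow max_l// ltW//; near: s; exact: lt_nbhsr.
(* At 0 the difference quotient is [pospow k.+1 h], which tends to 0. *)
- have : (fun h : R => h^-1 *: (pospow k.+2 (h *: 1 + 0) - pospow k.+2 0)) @
  0^' --> 0.
    have := @pospow_continuous k.+1 0; rewrite /continuous_at pospow_neg// => c0.
    have c1 : pospow k.+1 x @[x --> (0 : R)^'] --> (0 : R).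
      by apply: cvg_trans c0; apply: cvg_app; exact: cvg_within.
    apply: cvg_trans c1; apply: near_eq_cvg.
    near=> h; have h0 : h != 0 by near: h; exact: nbhs_dnbhs_neq.
    rewrite [pospow _ 0]pospow_neg// subr0 addr0 [h *: 1]mulr1 /pospow exprS.
    have [hp|hn] := leP h 0; first by rewrite !expr0n !mul0r scaler0.
    by rewrite -[RHS]/(h^-1 * h ^+ k.+2) [in RHS]exprS mulKf// exprS.
  move=> cv; apply: DeriveDef; first by apply/cvg_ex; exists 0; exact: cv.
  by rewrite [pospow _ 0]pospow_neg// mulr0; apply: cvg_lim.
Unshelve. all: by end_near. Qed.

Lemma C2_on_pospow n (U : set 'rV[R]_n) f : open U -> C2_on U f ->
  C2_on U (fun x => pospow 3 (f x)).
Proof.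
move=> oU C2f.
apply: (@C2_on_comp _ _ U (pospow 3) (fun t => 3%:R * pospow 2 t)
   (fun t => 3%:R * (2%:R * pospow 1 t))) => //.
- by move=> t; exact: pospow_is_derive.
- move=> t; have := pospow_is_derive 0 t => h.
  have H : is_derive t 1 (3%:R *: pospow 2) (3%:R *: (2%:R * pospow 1 t)).
    exact: is_deriveZ.
  exact: H.
- move=> t; exact: (continuousM (@cst_continuous _ _ (3%:R : R) t)
    (continuousM (@cst_continuous _ _ (2%:R : R) t) (@pospow_continuous 1 t))).
Qed.

(** The plateau r/2 matches a covering by half balls; the radius 3r/4 makes the support a compact
    subset of the open ball of radius [r]. *)
Lemma C2_cutoff n (c : 'rV[R]_n) (r : R) : 0 < r -> exists chi : 'rV[R]_n -> R,
  [/\ C2_on setT chi, forall x, 0 <= chi x <= 1,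
      forall x, enorm (x - c) <= r / 2 -> chi x = 1 &
      forall x, ~ eball_closed c (3 / 4 * r) x -> chi x = 0].
Proof.
move=> r0; pose q x := (16 / r ^+ 2 * enorm (x - c) ^+ 2 - 4) / 5.
(* q <= 0 on the ball of radius r / 2 and q >= 1 outside the one of radius
  3r/4. *)
exists (fun x => pospow 3 (1 - pospow 3 (q x))); split.
- apply: C2_on_pospow; first exact: openT.
  have C2N f : C2_on setT f -> C2_on setT (fun x : 'rV[R]_n => -1 * f x).
    by move=> C2f; apply: C2_onM C2f; [exact: openT|exact: C2_on_cst].
  have C2q : C2_on setT q.
    apply: (C2_onM openT _ (C2_on_cst setT 5^-1)).
    apply: (C2_onD openT _ (C2_on_cst setT (- 4))).
    by apply: (C2_onM openT (C2_on_cst setT _)); exact: enorm_sqr_C2.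
  apply: eq_C2_on (C2_onD openT (C2_on_cst setT 1)
    (C2N _ (C2_on_pospow openT C2q))); first exact: openT.
  by move=> x _; rewrite mulN1r.
- move=> x; rewrite pospow_ge0/= /pospow exprn_ile1// ?le_max ?lexx ?orbT//.
  by rewrite ge_max ler01 andbT gerBl -/(pospow 3 _) pospow_ge0.
- move=> x xr; rewrite (@pospow_neg 2 (q x)).
    by rewrite subr0 /pospow max_l ?ler01// expr1n.
  rewrite /q pmulr_lle0 ?invr_gt0// subr_le0 mulrAC ler_pdivrMr ?exprn_gt0//.
  have : enorm (x - c) ^+ 2 <= (r / 2) ^+ 2.
    by rewrite ler_sqr ?nnegrE ?enorm_ge0// divr_ge0 // ltW.
  by rewrite expr_div_n; lra.
- move=> x /negP; rewrite -ltNge => xr; apply: pospow_neg; rewrite subr_le0.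
  rewrite /pospow exprn_ege1// le_max; apply/orP; left.
  rewrite /q ler_pdivlMr// mul1r lerBrDr mulrAC ler_pdivlMr ?exprn_gt0//.
  have : (3 / 4 * r) ^+ 2 <= enorm (x - c) ^+ 2.
    rewrite ler_sqr ?nnegrE ?enorm_ge0//; first exact: ltW.
    by rewrite mulr_ge0// ltW.
  by rewrite exprMn; lra.
Qed.

End cutoff.

(** * The Frobenius norm and the entries *)

Section frobenius.
Context {R : realType} {n : nat}.
Implicit Types M : 'M[R]_n.

Lemma frobenius_ge0 M : 0 <= frobenius M.
Proof. exact: sqrtr_ge0. Qed.

Lemma coef_le_frobenius M i j : `|M i j| <= frobenius M.
Proof.
rewrite -sqrtr_sqr ler_sqrt; last first.
  by apply: sumr_ge0 => k _; apply: sumr_ge0 => l _; exact: sqr_ge0.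
rewrite (bigD1 i)//= (bigD1 j)//= -addrA lerDl addr_ge0//.
  by apply: sumr_ge0 => l _; exact: sqr_ge0.
by apply: sumr_ge0 => k _; apply: sumr_ge0 => l _; exact: sqr_ge0.
Qed.

(** The Frobenius norm is the Euclidean norm of the vector of row norms, so the comparison with the
    sum of absolute values is used twice. *)
Lemma frobenius_le_sum M : frobenius M <= \sum_i \sum_j `|M i j|.
Proof.
pose v : 'rV[R]_n := \row_i enorm (row i M).
have -> : frobenius M = enorm v.
  congr Num.sqrt; apply: eq_bigr => i _; rewrite mxE enorm_sqr.
  by apply: eq_bigr => j _; rewrite mxE.
rewrite (le_trans (enorm_le_sum _))//; apply: ler_sum => i _.
rewrite mxE ger0_norm ?enorm_ge0// (le_trans (enorm_le_sum _))//.
by apply: ler_sum => j _; rewrite mxE.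
Qed.

End frobenius.

(** * Gluing of local weak Hessians *)

Section glue.
Context {R : realType} {n : nat}.
Local Notation mu := (lebesgue_rV R n).

Lemma Rintegral_sum (N : nat) (f : nat -> 'rV[R]_n -> R) :
  (forall k, mu.-integrable setT (EFin \o f k)) ->
  mu.-integrable setT (EFin \o (fun x => \sum_(k < N) f k x)) /\
  \int[mu]_x (\sum_(k < N) f k x) = \sum_(k < N) \int[mu]_x f k x.
Proof.
move=> fi; elim: N => [|N [IH1 IH2]].
  rewrite (_ : (fun x => _) = cst 0); last by apply/funext => x; rewrite big_ord0.
  rewrite big_ord0; split; first exact: integrable0.
  by rewrite /Rintegral integral0.
rewrite (_ : (fun x => \sum_(k < N.+1) f k x) =
             (fun x => \sum_(k < N) f k x + f N x)); last first.
  by apply/funext => x; rewrite big_ord_recr.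
rewrite big_ord_recr/= -IH2; split;
  first exact: (integrableD measurableT IH1 (fi N)).
by rewrite RintegralD.
Qed.

(* The local Hessians are glued with the telescoping partition of unity
   eta_k = chi_k (1 - chi_0) ... (1 - chi_(k-1)), so that the uniqueness of weak
   Hessians is not needed. *)
Lemma weak_hessian_glue (U : set 'rV[R]_n) (u : 'rV[R]_n -> R) (D : set nat)
    (c : nat -> 'rV[R]_n) (r : nat -> R) (H : nat -> 'rV[R]_n -> 'M[R]_n) :
  (forall k, D k -> 0 < r k) ->
  (forall k, D k -> weak_hessian (eball (c k) (r k)) u (H k)) ->
  (forall x, U x -> exists2 k, D k & enorm (x - c k) < r k / 2) ->
  exists2 G, weak_hessian U u G &
    forall x, U x -> exists k, [/\ D k, eball (c k) (r k) x &
      frobenius (G x) <= (n * n)%:R * frobenius (H k x)].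
Proof.
move=> r0 uH cov.
pose S k := eball_closed (c k) (3 / 4 * r k).
have cS k : compact (S k) by exact: compact_eball_closed.
have SB k : D k -> S k `<=` eball (c k) (r k).
  move=> Dk x; rewrite /S /eball_closed/eball/= => xS; rewrite (le_lt_trans xS)//.
  by have := r0 k Dk; lra.
(* Indices outside [D] get the cut-off 0, so that all sums can run over initial segments of
   [nat]. *)
have /choice[chi chiP] : forall k, exists chi : 'rV[R]_n -> R,
    [/\ C2_on setT chi, forall x, 0 <= chi x <= 1,
      D k -> forall x, enorm (x - c k) <= r k / 2 -> chi x = 1,
      forall x, ~ S k x -> chi x = 0 & ~ D k -> forall x, chi x = 0].
  move=> k; have [Dk|Dk] := pselect (D k).
    by have [chi [? ? ? ?]] := C2_cutoff (c k) (r0 k Dk); exists chi.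
  exists (cst 0); split => //; first exact: C2_on_cst.
  by move=> x; rewrite lexx ler01.
(* [rem N] is the part of 1 not yet distributed by the first [N] functions [eta k]. It vanishes at
   [x] once some k < N in [D] has [x] in its half ball. *)
pose rem N x := \prod_(k < N) (1 - chi k x).
pose eta k x := chi k x * rem k x.
have remS N x : rem N.+1 x = rem N x * (1 - chi N x) by rewrite /rem big_ord_recr.
have chi01 k x : 0 <= chi k x <= 1 by have [_ /(_ x)] := chiP k.
have rem_ge0 N x : 0 <= rem N x.
  apply: prodr_ge0 => k _; rewrite subr_ge0.
  by case/andP: (chi01 k x).
have eta_ge0 k x : 0 <= eta k x.
  by rewrite mulr_ge0//; case/andP: (chi01 k x).
have sum_eta N x : \sum_(k < N) eta k x = 1 - rem N x.
  elim: N => [|N IHN]; first by rewrite big_ord0 /rem big_ord0 subrr.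
  by rewrite big_ord_recr/= IHN remS /eta; ring.
have rem_le N N' x : (N <= N')%N -> rem N x = 0 -> rem N' x = 0.
  move=> /subnK <- rN; elim: (N' - N)%N => [//|m IHm].
  by rewrite addSn remS IHm mul0r.
have C2rem N : C2_on setT (rem N).
  elim: N => [|N IHN].
    by apply: eq_C2_on (C2_on_cst setT 1) => [|x _];
      [exact: openT|rewrite /rem big_ord0].
  have C2m : C2_on setT (fun x => cst 1 x + (cst (-1) x * chi N x)).
    apply: C2_onD; [exact: openT|exact: C2_on_cst|].
    by apply: C2_onM; [exact: openT|exact: C2_on_cst|case: (chiP N)].
  apply: eq_C2_on (C2_onM openT IHN C2m) => [|x _]; first exact: openT.
  by rewrite remS /= mulN1r.
have C2eta k : C2_on setT (eta k).
  by apply: C2_onM; [exact: openT|case: (chiP k)|exact: C2rem].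
have eta_cont k : continuous (eta k).
  by move=> x; exact: (C1_on_continuous (proj1 (C2eta k)) (I : setT x)).
have etaS k x : ~ S k x -> eta k x = 0.
  by move=> Sx; rewrite /eta; have [_ _ _ -> //] := chiP k; rewrite mul0r.
have etaD k x : ~ D k -> eta k x = 0.
  by move=> Dk; rewrite /eta; have [_ _ _ _ ->] := chiP k; rewrite ?mul0r.
have rem0 k N x : D k -> (k < N)%N -> enorm (x - c k) <= r k / 2 -> rem N x = 0.
  move=> Dk kN xk; rewrite /rem (bigD1 (Ordinal kN))//=.
  by have [_ _ -> //] := chiP k; rewrite subrr mul0r.
have /choice[Nf NfP] : forall x, exists N, U x -> rem N x = 0.
  move=> x; have [Ux|Ux] := pselect (U x); last by exists 0%N.
  have [k Dk xk] := cov _ Ux; exists k.+1 => _.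
  exact: (rem0 k _ _ Dk (leqnn _) (ltW xk)).
(* The number of terms depends on the point. Any [N] with [rem N x = 0] gives the same sum, because
   the later [eta k] vanish at [x]. *)
pose G x := \sum_(k < Nf x) eta k x *: H k x.
have sum_stable (V : lmodType R) (F : nat -> V) N N' x : rem N x = 0 -> rem N'
  x = 0 ->
    \sum_(k < N) eta k x *: F k = \sum_(k < N') eta k x *: F k.
  wlog NN' : N N' / (N <= N')%N.
    by move=> h rN rN'; have [|/ltnW] := leqP N N' => NN'; [|apply/esym];
      exact: h.
  move=> rN _; rewrite -(subnKC NN'); elim: (N' - N)%N => [|m IHm];
    first by rewrite addn0.
  rewrite addnS big_ord_recr/= -IHm /eta (rem_le _ _ _ (leq_addr m N) rN).
  by rewrite mulr0 scale0r addr0.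
have GE N x : U x -> rem N x = 0 -> G x = \sum_(k < N) eta k x *: H k x.
  by move=> Ux rN; exact: (sum_stable _ (fun k => H k x) _ _ _ (NfP _ Ux) rN).
have GEij N x i j : U x -> rem N x = 0 ->
    G x i j = \sum_(k < N) H k x i j * eta k x.
  move=> Ux rN; rewrite (GE N)// summxE; apply: eq_bigr => k _.
  by rewrite mxE mulrC.
(* A finite subcover by half balls gives one [N] for all points of [K], so only finite sums occur
   under integrals against a test function. *)
have compactN K : compact K -> K `<=` U -> exists N, forall x, K x -> rem N x = 0.
  move=> cK KU.
  have := cK; rewrite compact_cover => /(_ _ D (fun k => eball (c k) (r k / 2))).
  case=> [k _|x Kx|D' D'D KD']; first exact: open_eball.
    by have [k Dk xk] := cov _ (KU _ Kx); exists k.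
  exists (\max_(k <- finmap.enum_fset D') k)%N.+1 => x /KD'[k /= kD' xk].
  have Dk : D k by exact: set_mem (D'D _ kD').
  by apply: (rem0 k) => //; [rewrite ltnS leq_bigmax_seq|exact: ltW].
have ieta (w : 'rV[R]_n -> R) g k : (D k -> Lp_loc 1 (eball (c k) (r k)) w) ->
    continuous g -> (forall x, ~ S k x -> g x = 0) -> (~ D k -> forall x,
      g x = 0) ->
    mu.-integrable setT (EFin \o (fun x => w x * g x)).
  move=> lw cg gS gD; have [Dk|Dk] := pselect (D k).
    exact: (Lp_loc1_integrableM (lw Dk) (SB k Dk) (cS k) cg gS).
  apply: (eq_integrable measurableT (cst 0%E)); last exact: integrable0.
  by move=> x _ /=; rewrite gD// mulr0.
have Lsum (w : 'rV[R]_n -> R) (wk : nat -> 'rV[R]_n -> R) :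
    (forall k, D k -> Lp_loc 1 (eball (c k) (r k)) (wk k)) ->
    (forall N x, U x -> rem N x = 0 -> w x = \sum_(k < N) wk k x * eta k x) ->
    Lp_loc 1 U w.
  move=> lw wE K cK KU; apply/(Lp_on1_integrable _ cK).
  have [N rN] := compactN _ cK KU; have mK := measurable_compact_rV cK.
  apply: (eq_integrable mK (EFin \o (fun x => \sum_(k < N) wk k x * eta k x))).
    by move=> x /set_mem Kx /=; rewrite (wE N)//; [exact: KU|exact: rN].
  apply: (integrableS measurableT mK) => //.
  apply: (proj1 (Rintegral_sum N (f := fun k x => wk k x * eta k x) _)) => k.
  by apply: ieta => //; [exact: lw|exact: etaS|move=> ? ?; exact: etaD].
exists G; first split.
- apply: (Lsum _ (fun=> u)); first by move=> k Dk; case: (uH k Dk).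
  move=> N x Ux rN.
  by rewrite -mulr_sumr sum_eta rN subr0 mulr1.
- move=> i j; apply: (Lsum _ (fun k x => H k x i j)).
    by move=> k Dk; have [_ lH _] := uH k Dk; exact: lH.
  by move=> N x Ux rN; exact: GEij.
- move=> psi [C2p [K [cK KU p0]]] i j.
  have [N rN] := compactN _ cK KU.
  have C2ep k : C2_on setT (fun x => eta k x * psi x).
    by apply: C2_onM; [exact: openT|exact: C2eta|exact: C2p].
  have epS k x : ~ S k x -> eta k x * psi x = 0 by move=> /etaS ->; rewrite mul0r.
  (* This splits [psi] into test functions each supported in a single ball, where a local Hessian
     can be used. *)
  have psiE : psi = fun x => \sum_(k < N) eta k x * psi x.
    apply/funext => x; rewrite -mulr_suml sum_eta.
    have [Kx|Kx] := pselect (K x); first by rewrite rN// subr0 mul1r.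
    by rewrite p0// mulr0.
  have [h hk] : exists h : nat -> 'rV[R]_n -> R,
      forall k, h k = (fun x => hessian (fun x => eta k x * psi x) x i j).
    by eexists.
  have hE x : hessian psi x i j = \sum_(k < N) h k x.
    rewrite [in LHS]psiE.
    rewrite (@hessian_sum _ _ _ _ (fun (k : 'I_N) x => eta k x * psi x) x i j
      (fun k => C2ep k)).
    by apply: eq_bigr => k _; rewrite hk.
  have ch k : continuous (h k) 
    by rewrite hk; exact: (@hessian_continuous _ _ (fun x => eta k x * psi x) i
      j (C2ep k)).
  have h0 x : ~ K x -> hessian psi x i j = 0.
    move=> Kx; rewrite mxE; apply: (partial_off_support _ cK) Kx.
    exact: partial_off_support.
  rewrite (RintegralM_support _ KU h0) (RintegralM_support _ KU p0).
  have hS k x : ~ S k x -> h k x = 0.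
    move=> Sx; rewrite hk mxE; apply: (partial_off_support _ (cS k)) Sx.
    by apply: partial_off_support => //; exact: epS.
  have hD k : ~ D k -> forall x, h k x = 0.
    move=> Dk x; rewrite hk (_ : (fun x => _ * _) = cst 0).
      rewrite mxE (_ : partial j (cst 0) = cst 0) ?partial_cst//.
      by apply/funext => y; rewrite partial_cst.
    by apply/funext => y; rewrite etaD// mul0r.
  have hB k : D k -> \int[mu]_(x in eball (c k) (r k)) (u x * h k x) =
      \int[mu]_(x in eball (c k) (r k)) (H k x i j * (eta k x * psi x)).
    move=> Dk; have [_ _ uHk] := uH k Dk.
    have epC : C2_compact (eball (c k) (r k)) (fun x => eta k x * psi x).
      by split; [exact: C2ep|exists (S k); split;
        [exact: cS|exact: SB|exact: epS]].
    rewrite -(uHk _ epC i j); apply: eq_Rintegral => x _.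
    by congr (_ * _); rewrite hk.
  clear hk.
  transitivity (\int[mu]_x (\sum_(k < N) u x * h k x)).
    by apply: eq_Rintegral => x _; rewrite hE mulr_sumr.
  rewrite (proj2 (Rintegral_sum N (f := fun k x => u x * h k x) _)); last first.
    move=> k; apply: (ieta _ _ k) => //.
    + by move=> Dk; case: (uH k Dk).
    + exact: hS.
    + exact: hD.
  transitivity (\int[mu]_x (\sum_(k < N) H k x i j * (eta k x * psi x)));
    last first.
    apply: eq_Rintegral => x _.
    have [Kx|Kx] := pselect (K x); last first.
      by rewrite p0// mulr0 big1// => k _; rewrite !mulr0.
    rewrite (GEij N)//; [|exact: KU|exact: rN].
    by rewrite mulr_suml; apply: eq_bigr => k _; rewrite mulrA.
  rewrite (proj2 (Rintegral_sum N
    (f := fun k x => H k x i j * (eta k x * psi x)) _)); last first.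
    move=> k; apply: (ieta _ _ k).
    + by move=> Dk; have [_ lH _] := uH k Dk; exact: lH.
    + by move=> x; exact: (C1_on_continuous (proj1 (C2ep k)) (I : setT x)).
    + exact: epS.
    + by move=> Dk x; rewrite etaD// mul0r.
  apply: eq_bigr => k _; have [Dk|Dk] := pselect (D k).
    rewrite -(RintegralM_support _ (SB k Dk) (hS k)).
    by rewrite -(RintegralM_support _ (SB k Dk) (epS k)) hB.
  by apply: eq_Rintegral => x _; rewrite hD// etaD// mul0r !mulr0.
(* The weights [eta k x] add up to 1, so the norm of [G x] is at most n^2 times a weighted mean of
   the norms of the [H k x]. If it exceeded n^2 times each norm of positive weight, a sum of
   nonnegative terms would be at most 0 and all weights would vanish. *)
- move=> x Ux; apply: contrapT => nk.
  have rN := NfP x Ux; set N := Nf x in rN.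
  have lt k : D k -> eball (c k) (r k) x ->
      (n * n)%:R * frobenius (H k x) < frobenius (G x).
    by move=> Dk xk; rewrite ltNge; apply/negP => h; apply: nk; exists k.
  have le_term k : 0 <= eta k x * (frobenius (G x) - (n * n)%:R * frobenius (H
    k x)).
    have [Dk|Dk] := pselect (D k); last by rewrite etaD// mul0r.
    have [Sx|Sx] := pselect (S k x); last by rewrite etaS// mul0r.
    by rewrite mulr_ge0// subr_ge0 ltW// lt//; exact: SB.
  have sumle : frobenius (G x) <=
      (n * n)%:R * \sum_(k < N) eta k x * frobenius (H k x).
    rewrite (le_trans (frobenius_le_sum _))//.
    set B := \sum_(k < N) _.
    have -> : (n * n)%:R * B = \sum_(i < n) \sum_(j < n) B.
      by rewrite !sumr_const !card_ord -mulrnA mulr_natl.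
    apply: ler_sum => i _; apply: ler_sum => j _.
    rewrite (GEij N)// (le_trans (ler_norm_sum _ _ _))//.
    apply: ler_sum => k _; rewrite normrM mulrC ger0_norm//.
    by rewrite ler_wpM2l// coef_le_frobenius.
  have sum0 : \sum_(k < N) eta k x * (frobenius (G x) - (n * n)%:R * frobenius
    (H k x)) = 0.
    apply/eqP; rewrite eq_le; apply/andP; split; last exact: sumr_ge0.
    under eq_bigr do rewrite mulrBr;
      rewrite sumrB -mulr_suml sum_eta rN subr0 mul1r.
    rewrite subr_le0 (le_trans sumle)// mulr_sumr; apply: ler_sum => k _.
    by rewrite mulrCA.
  have : \sum_(k < N) eta k x = 0.
    apply: big1 => k _; move/eqP: sum0;
      rewrite psumr_eq0// => /allP/(_ k (mem_index_enum _)).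
    rewrite mulf_eq0 => /orP[/eqP//|].
    have [Dk|Dk] := pselect (D k); last by rewrite etaD.
    have [Sx|Sx] := pselect (S k x); last by rewrite etaS.
    by rewrite subr_eq0 eq_sym (lt_eqF (lt _ Dk (SB k Dk _ Sx))).
  by rewrite sum_eta rN subr0 => /eqP; rewrite oner_eq0.
Qed.

End glue.

(** * Measurability from local integrability *)

Section exhaustion.
Context {R : realType} {n : nat}.
Implicit Types (U : set 'rV[R]_n) (u : 'rV[R]_n -> R).
Local Notation mu := (lebesgue_rV R n).

Lemma open_eball_sub U x : open U -> U x ->
  exists2 e : R, 0 < e & eball x e `<=` U.
Proof.
move=> oU Ux; have /nbhs_ballP[e /= e0 eU] : nbhs x U by exact: open_nbhs_nbhs.
exists e => // y /eball_sub_box ye; apply: eU; rewrite mx_norm_ball /ball_/=.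
by rewrite mx_norm_lt//; apply/forallP => i; have := ye i; rewrite !mxE distrC.
Qed.

(** [K k] consists of the points of the closed ball of radius [k] at distance at least 1/(k+1) from
    every point outside [U]. Local integrability gives measurability on these compact sets, and
    hence on [U]. *)
Lemma open_exhaustion U : open U -> exists K : nat -> set 'rV[R]_n,
  [/\ forall k, compact (K k), forall k, K k `<=` U & U = \bigcup_k K k].
Proof.
move=> oU; pose e k : R := k.+1%:R^-1.
have e0 k : 0 < e k by rewrite invr_gt0.
pose K k := eball_closed (0 : 'rV[R]_n) k%:R `&` ~` (\bigcup_(y in ~` U) eball
  y (e k)).
have KU k : K k `<=` U.
  move=> x [_ nx]; apply: contrapT => Ux; apply: nx; exists x => //.
  by rewrite /eball/= subrr enorm0.
exists K; split => //.
- move=> k; apply: compact_closedI; first exact: compact_eball_closed.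
  by apply: open_closedC; apply: bigcup_open => y _; exact: open_eball.
- apply/seteqP; split => [x Ux|x [k _]]; last exact: KU.
  have [d d0 dU] := open_eball_sub oU Ux.
  have [k /= kd] : exists k : nat, k.+1%:R^-1 < d.
    by have [k _ /(_ k (leqnn k))] := near_infty_natSinv_lt (PosNum d0); exists k.
  have [l xl] : exists l : nat, enorm x <= l%:R.
    exists (Num.truncn (enorm x)).+1; rewrite ltW//.
    by have /truncn_itv/andP[] := enorm_ge0 x.
  exists (maxn k l) => //; split.
    rewrite /eball_closed/= subr0 (le_trans xl)// ler_nat; exact: leq_maxr.
  move=> [y nUy]; rewrite /eball/= => xy; apply: nUy; apply: dU.
  rewrite /eball/= enormB (lt_trans xy)// (le_lt_trans _ kd)//.
  by rewrite /e lef_pV2 ?posrE// ler_nat ltnS leq_maxl.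
Qed.

Lemma Lp_loc1_measurable U u : open U -> Lp_loc 1 U u -> measurable_fun U u.
Proof.
move=> oU lu; have [K [cK KU UE]] := open_exhaustion oU.
rewrite UE; apply/measurable_fun_bigcup.
  by move=> k; apply: measurable_compact_rV.
move=> k; have /(Lp_on1_integrable _ (cK k)) : Lp_on 1 (K k) u by exact: lu.
by move=> /measurable_int/measurable_EFinP.
Qed.

Lemma weak_hessian_frobenius_measurable U u H : open U -> weak_hessian U u H ->
  measurable_fun U (fun x => frobenius (H x)).
Proof.
move=> oU [_ lH _].
have mH i j : measurable_fun U (fun x => H x i j) by exact: Lp_loc1_measurable.
apply: (@measurableT_comp _ _ _ _ _ _ (@Num.sqrt R)).
  by apply: continuous_measurable_fun; exact: sqrt_continuous.
apply: measurable_sum => i; apply: measurable_sum => j.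
exact: measurable_funX.
Qed.

End exhaustion.

(** * Norms in L^p and the interior estimate *)

Section Lp_norms.
Context {R : realType} {n : nat}.
Implicit Types (D : set 'rV[R]_n) (g : 'rV[R]_n -> R).
Local Notation mu := (lebesgue_rV R n).

Lemma Lp_norm_powR p D g : 0 < p ->
  (Lp_norm p%:E D g `^ p = \int[mu]_(x in D) (`|g x| `^ p)%:E)%E.
Proof.
move=> p0; rewrite /Lp_norm poweR_Lnorm; last by rewrite gt_eqF.
rewrite [RHS]integral_mkcond.
apply: eq_integral => x _ /=; rewrite /patch; case: ifPn => //= _.
by rewrite normr0 powR0 ?gt_eqF.
Qed.

Lemma Lp_norm_integral p D g : 0 < p ->
  (Lp_norm p%:E D g = (\int[mu]_(x in D) (`|g x| `^ p)%:E) `^ p^-1)%E.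
Proof.
move=> p0; rewrite -Lp_norm_powR// -poweRrM mulfV ?gt_eqF// poweRe1//.
exact: Lnorm_ge0.
Qed.

Lemma Lp_norm_bounded D g S : 0 <= S -> (forall x, D x -> `|g x| <= S) ->
  (Lp_norm +oo D g <= S%:E)%E.
Proof.
move=> S0 gS; rewrite /Lp_norm unlock /Lnorm; case: ifPn => _;
  last by rewrite lee_fin.
apply/ess_sup_inf.ess_supP; apply: aeW => x /=; rewrite lee_fin /patch.
by case: ifPn => [/set_mem /gS//|_]; rewrite normr0.
Qed.

Lemma Lp_on_measurable p D g : measurable D -> Lp_on p D g -> measurable_fun D g.
Proof.
move=> mD; rewrite /Lp_on inE => /andP[/[!inE]/= mg _].
exact/(measurable_restrictT _ mD).
Qed.

Lemma Lp_on_fin p D g : Lp_on p D g -> (Lp_norm p D g < +oo)%E.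
Proof. by rewrite /Lp_on inE => /andP[_]; rewrite inE. Qed.

Lemma measurable_fun_powRn p D g : measurable_fun D g ->
  measurable_fun D (fun x => (`|g x| `^ p)%:E).
Proof.
move=> mg; apply: measurableT_comp => //.
apply: (@measurableT_comp _ _ _ _ _ _ (@powR R ^~ p)) => //.
exact: measurableT_comp.
Qed.

Lemma measurable_eball (c : 'rV[R]_n) r : measurable (eball c r).
Proof. by apply: measurable_open_rV; exact: open_eball. Qed.

(** [D2_norm] is an infimum over weak Hessians, so selecting one of them costs a positive slack [t].
    The constant enters through its absolute value because the sign of [ce] is not prescribed. *)
Lemma interior_ball_estimate s p ce U F f v x0 (r S t : R) :
  1 <= p -> measurable U -> interior_W2p_estimate s p ce U F f ->
  solution s p U F f v ->
  Lp_on p%:E U f -> 0 < r -> eball x0 r `<=` U -> 0 <= S ->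
  (forall x, eball x0 r x -> `|v x| <= S) -> 0 < t ->
  exists H a, [/\ weak_hessian (eball x0 (r / 2)) v H, 0 <= a,
    (\int[mu]_(x in eball x0 r) (`|f x| `^ p)%:E = (a `^ p)%:E)%E &
    (\int[mu]_(x in eball x0 (r / 2)) (frobenius (H x) `^ p)%:E <=
      ((`|ce| * (r `^ (n%:R / p - 2) * S + a) + t) `^ p)%:E)%E].
Proof.
move=> p1 mU int_est sol fp r0 rU S0 vS t0.
have p0 : 0 < p by rewrite (lt_le_trans ltr01).
have := int_est v x0 r sol r0 rU => est.
have fU := Lp_on_measurable mU fp.
have fin_f : (Lp_norm p%:E (eball x0 r) f < +oo)%E.
  rewrite Lp_norm_integral//; apply: poweR_lty.
  apply: (@le_lt_trans _ _ (\int[mu]_(x in U) (`|f x| `^ p)%:E)%E).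
    apply: ge0_subset_integral => //; first exact: measurable_eball.
    exact: measurable_fun_powRn.
  by rewrite -Lp_norm_powR//; apply: poweR_lty; exact: Lp_on_fin.
have f_ge0 : (0 <= Lp_norm p%:E (eball x0 r) f)%E by exact: Lnorm_ge0.
set a := fine (Lp_norm p%:E (eball x0 r) f).
have aE : Lp_norm p%:E (eball x0 r) f = a%:E.
  by rewrite /a fineK// ge0_fin_numE.
have a0 : 0 <= a by rewrite -lee_fin -aE.
have estT : (D2_norm p%:E (eball x0 (r / 2)) v <
    (`|ce| * (r `^ (n%:R / p - 2) * S + a) + t)%:E)%E.
  apply: (@le_lt_trans _ _ (`|ce| * (r `^ (n%:R / p - 2) * S + a))%:E);
    last first.
    by rewrite lte_fin ltrDl.
  apply: (le_trans est); rewrite aE.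
  have rv : ((r `^ (n%:R / p - 2))%:E * Lp_norm +oo (eball x0 r) v + a%:E <=
             (r `^ (n%:R / p - 2) * S + a)%:E)%E.
    rewrite EFinD EFinM; apply: leeD => //; apply: lee_wpmul2l.
      by rewrite lee_fin powR_ge0.
    exact: Lp_norm_bounded.
  have rv0 : (0 <= (r `^ (n%:R / p - 2))%:E * Lp_norm +oo (eball x0 r) v +
    a%:E)%E.
    apply: adde_ge0; last by rewrite lee_fin.
    by apply: mule_ge0; [rewrite lee_fin powR_ge0|exact: Lnorm_ge0].
  rewrite EFinM; apply: (@le_trans _ _ (`|ce|%:E * ((r `^ (n%:R / p - 2))%:E *
      Lp_norm +oo (eball x0 r) v + a%:E))%E).
    by apply: lee_wpmul2r => //; rewrite lee_fin ler_norm.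
  by apply: lee_wpmul2l.
have [_ [H vH <-] HT] := ereal_inf_lt estT.
exists H, a; split => //; first by rewrite -Lp_norm_powR// aE.
under eq_integral => x _ do rewrite -(ger0_norm (frobenius_ge0 (H x))).
rewrite -Lp_norm_powR// -poweR_EFin.
apply: gt0_ler_poweR; first exact: ltW.
- by rewrite in_itv/= leey andbT; exact: Lnorm_ge0.
- by rewrite in_itv/= leey andbT lee_fin addr_ge0 ?(ltW t0)// mulr_ge0//
  addr_ge0// mulr_ge0// powR_ge0.
- exact: ltW.
Qed.

Lemma powR_gt0D (a x y : R) : 0 < a -> a `^ (x + y) = a `^ x * a `^ y.
Proof. by move=> a0; rewrite powRD// (gt_eqF a0) implybT. Qed.

(** If x <= l the first term suffices; otherwise x^(q-p) <= l^(q-p), as the exponent is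
    nonpositive. *)
Lemma powR_le_split (q p l x : R) : 0 < l -> 0 <= x -> 0 <= q -> q <= p ->
  x `^ q <= l `^ q + l `^ (q - p) * x `^ p.
Proof.
move=> l0 x0 q0 qp; have [xl|lx] := leP x l.
  apply: (@le_trans _ _ (l `^ q)).
    by rewrite ge0_ler_powR ?nnegrE// ltW.
  by rewrite lerDl mulr_ge0// powR_ge0.
have x_gt0 : 0 < x by exact: lt_trans lx.
apply: (@le_trans _ _ (l `^ (q - p) * x `^ p)); last by rewrite lerDr powR_ge0.
rewrite -[in leLHS](subrK p q) (powR_gt0D (q - p) p x_gt0).
rewrite ler_wpM2r ?powR_ge0// -(opprB p q) !powRN lef_pV2 ?posrE ?powR_gt0//.
by rewrite ge0_ler_powR ?nnegrE ?subr_ge0 ?(ltW l0) ?(ltW x_gt0) ?(ltW lx).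
Qed.

(** The sum is at most twice the larger term. *)
Lemma powRD_le (p x y : R) : 0 <= p -> 0 <= x -> 0 <= y ->
  (x + y) `^ p <= 2 `^ p * (x `^ p + y `^ p).
Proof.
move=> p0 x0 y0; wlog xy : x y x0 y0 / x <= y.
  move=> h; have [|/ltW] := leP x y => xy; first exact: h.
  by rewrite addrC [X in _ * X]addrC; exact: h.
apply: (@le_trans _ _ ((2 * y) `^ p)).
  by rewrite ge0_ler_powR ?nnegrE ?addr_ge0 ?mulr_ge0//; lra.
by rewrite powRM// ler_wpM2l ?powR_ge0// lerDr powR_ge0.
Qed.

Lemma lebesgue_eball_le (c : 'rV[R]_n) r : 0 <= r ->
  (mu (eball c r) <= ((2 * r) ^+ n)%:E)%E.
Proof.
move=> r0; rewrite -(lebesgue_box c r0); apply: le_measure; rewrite ?inE.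
- exact: measurable_eball.
- exact: measurable_box.
- exact: eball_sub_box.
Qed.

Lemma integral_powR_le D g (q p l : R) : measurable D -> measurable_fun D g ->
  (forall x, D x -> 0 <= g x) -> 0 < l -> 0 < q -> q <= p ->
  (\int[mu]_(x in D) (g x `^ q)%:E <=
   (l `^ q)%:E * mu D + (l `^ (q - p))%:E * \int[mu]_(x in D) (g x `^ p)%:E)%E.
Proof.
move=> mD mg g0 l0 q0 qp.
have mgp s : measurable_fun D (fun x => (g x `^ s)%:E).
  apply: measurableT_comp => //.
  by apply: (@measurableT_comp _ _ _ _ _ _ (@powR R ^~ s)).
have ge0 s x : (0 <= (g x `^ s)%:E)%E by rewrite lee_fin powR_ge0.
rewrite -integral_cst// -ge0_integralZl//; [|by rewrite lee_fin powR_ge0].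
rewrite -ge0_integralD//.
- apply: ge0_le_integral => //.
  + apply: emeasurable_funD => //; apply: emeasurable_funM => //.
  + by move=> x Dx; rewrite -EFinM -EFinD lee_fin powR_le_split// ?g0// ltW.
- by move=> x _; rewrite lee_fin powR_ge0.
- by move=> x _; rewrite mule_ge0// lee_fin powR_ge0.
- by apply: emeasurable_funM.
Qed.

(* The L^q bound is obtained from the L^p bound by splitting at the level
   [r^(al - 1) * N]. *)
Lemma interior_ball_power_estimate (p q al ce cb K : R) :
  1 <= q -> q <= p -> al <= 1 -> 0 <= K -> 0 <= cb ->
  exists2 C, 0 <= C & forall s U F f v (x0 : 'rV[R]_n) (r N : R),
    measurable U -> interior_W2p_estimate s p ce U F f ->
    solution s p U F f v -> Lp_on p%:E U f ->
    0 < r -> r <= 1 -> eball x0 r `<=` U ->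
    (forall x, eball x0 r x -> `|v x| <= cb * (K * r) `^ (1 + al)) -> 1 <= N ->
    exists2 H, weak_hessian (eball x0 (r / 2)) v H &
      (\int[mu]_(x in eball x0 (r / 2)) (frobenius (H x) `^ q)%:E <=
       (C * (N `^ q * r `^ (n%:R + (al - 1) * q)))%:E +
       (C * N `^ (q - p))%:E * \int[mu]_(x in eball x0 r) (`|f x| `^ p)%:E)%E.
Proof.
move=> q1 qp al1 K0 cb0.
have q0 : 0 < q by rewrite (lt_le_trans ltr01).
have p1 : 1 <= p by exact: le_trans qp.
have p0 : 0 < p by rewrite (lt_le_trans ltr01).
pose C1 := `|ce| * (cb * K `^ (1 + al)) + 1.
have C1_ge0 : 0 <= C1 by rewrite addr_ge0// !mulr_ge0// powR_ge0.
pose C := 1 + 2 `^ p * C1 `^ p + 2 `^ p * `|ce| `^ p.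
have C_ge0 : 0 <= C by rewrite !addr_ge0// mulr_ge0// powR_ge0.
exists C => // s U F f v x0 r N mU est sol fp r0 r1 rU vS N1.
have N0 : 0 < N by rewrite (lt_le_trans ltr01).
(* The slack gets the exponent (n/p - 2) + (1 + al) of the main term, so it merely adds 1 to
   [C1]. *)
pose t := r `^ (n%:R / p + al - 1).
have t0 : 0 < t by exact: powR_gt0.
have S0 : 0 <= cb * (K * r) `^ (1 + al) by rewrite mulr_ge0// powR_ge0.
have [H [a [vH a0 fa Hp]]] :=
  interior_ball_estimate p1 mU est sol fp r0 rU S0 vS t0.
exists H => //; rewrite fa.
have rS : r `^ (n%:R / p - 2) * (cb * (K * r) `^ (1 + al)) =
    cb * K `^ (1 + al) * t.
  rewrite (powRM _ K0 (ltW r0)) /t (_ : n%:R / p + al - 1 = n%:R / p - 2 + (1 +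
    al)); last by lra.
  by rewrite (powR_gt0D (n%:R / p - 2) (1 + al) r0); ring.
have tp : t `^ p = r `^ (n%:R + (al - 1) * p).
  by rewrite /t -powRrM; congr (_ `^ _); field; rewrite gt_eqF.
have Tle : (`|ce| * (r `^ (n%:R / p - 2) * (cb * (K * r) `^ (1 + al)) + a) + t)
  `^ p
    <= 2 `^ p * (C1 `^ p * r `^ (n%:R + (al - 1) * p) + `|ce| `^ p * a `^ p).
  rewrite rS (_ : _ + t = C1 * t + `|ce| * a); last by rewrite /C1; ring.
  rewrite (le_trans (powRD_le _ _ _)) ?mulr_ge0 ?(ltW p0) ?(ltW t0)//.
  by rewrite !powRM ?(ltW t0)// tp.
(* With r^(al-1) in the level, l^q r^n and l^(q-p) r^(n+(al-1)p) carry the same power of [r]. *)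
pose l := r `^ (al - 1) * N.
have l0 : 0 < l by rewrite mulr_gt0// powR_gt0.
have oB := @open_eball R n x0 (r / 2).
have mH := weak_hessian_frobenius_measurable oB vH.
have := integral_powR_le (measurable_eball x0 (r / 2)) mH
  (fun x _ => frobenius_ge0 (H x)) l0 q0 qp.
move=> /le_trans; apply.
have muB : (mu (eball x0 (r / 2)) <= (r `^ n%:R)%:E)%E.
  rewrite (le_trans (lebesgue_eball_le _ _)) ?divr_ge0 ?(ltW r0)//.
  by rewrite (_ : 2 * (r / 2) = r) ?powR_mulrn ?(ltW r0)//; lra.
apply: (@le_trans _ _ ((l `^ q)%:E * (r `^ n%:R)%:E + (l `^ (q - p))%:E *
    (2 `^ p * (C1 `^ p * r `^ (n%:R + (al - 1) * p) + `|ce| `^ p * a `^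
      p))%:E)%E).
  apply: leeD; apply: lee_wpmul2l; rewrite ?lee_fin ?powR_ge0//.
  by rewrite (le_trans Hp)// lee_fin.
rewrite -!EFinM -!EFinD lee_fin.
have lE e : l `^ e = r `^ ((al - 1) * e) * N `^ e.
  by rewrite /l powRM ?powR_ge0 ?(ltW N0)// -powRrM.
have rD e e' : r `^ (e + e') = r `^ e * r `^ e' by exact: powR_gt0D.
have -> : l `^ q * r `^ n%:R = N `^ q * r `^ (n%:R + (al - 1) * q).
  by rewrite lE rD; ring.
have NN : N `^ (q - p) <= N `^ q by rewrite ler_powR// lerBlDr lerDl ltW.
have rr : r `^ ((al - 1) * (q - p)) <= 1.
  have e0 : 0 <= (al - 1) * (q - p) by rewrite mulr_le0 ?subr_le0.
  apply: (@le_trans _ _ (1 `^ ((al - 1) * (q - p)))); last by rewrite powR1.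
  by rewrite ge0_ler_powR ?nnegrE ?(ltW r0).
set X := r `^ (n%:R + (al - 1) * q).
have X0 : 0 <= X by exact: powR_ge0.
have -> : l `^ (q - p) * (2 `^ p * (C1 `^ p * r `^ (n%:R + (al - 1) * p) +
      `|ce| `^ p * a `^ p)) =
    2 `^ p * C1 `^ p * (N `^ (q - p) * X) +
    2 `^ p * `|ce| `^ p * (r `^ ((al - 1) * (q - p)) * (N `^ (q - p) * a `^ p)).
  rewrite lE /X (_ : n%:R + (al - 1) * q =
    (al - 1) * (q - p) + (n%:R + (al - 1) * p)); last by ring.
  by rewrite (rD ((al - 1) * (q - p))); ring.
have Na0 : 0 <= N `^ (q - p) * a `^ p by rewrite mulr_ge0// powR_ge0.
have A0 : 0 <= 2 `^ p * C1 `^ p by rewrite mulr_ge0// powR_ge0.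
have B0 : 0 <= 2 `^ p * `|ce| `^ p by rewrite mulr_ge0// powR_ge0.
have h1 : 2 `^ p * C1 `^ p * (N `^ (q - p) * X) <= 2 `^ p * C1 `^ p * (N `^ q *
  X).
  by rewrite ler_wpM2l// ler_wpM2r.
have h2 : 2 `^ p * `|ce| `^ p * (r `^ ((al - 1) * (q - p)) * (N `^ (q - p) * a
  `^ p))
    <= 2 `^ p * `|ce| `^ p * (N `^ (q - p) * a `^ p).
  by rewrite ler_wpM2l// -[leRHS]mul1r ler_wpM2r.
have NX : 0 <= N `^ q * X by rewrite mulr_ge0// powR_ge0.
rewrite -[C * N `^ (q - p) * _]mulrA /C.
move: A0 B0 h1 h2 Na0 NX.
set A := 2 `^ p * C1 `^ p; set B := 2 `^ p * `|ce| `^ p.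
set Y := N `^ (q - p) * a `^ p; set Z := N `^ q * X => A0 B0 h1 h2 Y0 Z0.
have AY : 0 <= A * Y by exact: mulr_ge0.
have BZ : 0 <= B * Z by exact: mulr_ge0.
rewrite (_ : (1 + A + B) * Z + (1 + A + B) * Y =
  Z + (A * Z + B * Y) + (B * Z + Y + A * Y)); last by ring.
by rewrite (le_trans (lerD (lexx Z) (lerD h1 h2)))// lerDl !addr_ge0.
Qed.

End Lp_norms.

(** * Splitting off the last coordinate *)

Section coordinates.
Context {R : realType} {n : nat}.
Implicit Types x y : 'rV[R]_n.+1.

Lemma rV_splitB1 x y : (rV_split (x - y)).1 = (rV_split x).1 - (rV_split y).1.
Proof. by apply/rowP => i; rewrite !mxE. Qed.

Lemma rV_splitB2 x y : (rV_split (x - y)).2 = (rV_split x).2 - (rV_split y).2.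
Proof. by rewrite /rV_split/= !mxE. Qed.

Lemma rV_split0 : rV_split (0 : 'rV[R]_n.+1) = (0, 0).
Proof. by congr pair; [apply/rowP => i|]; rewrite !mxE. Qed.

Lemma enorm_split x : enorm x ^+ 2 = enorm (rV_split x).1 ^+ 2 + (rV_split x).2
  ^+ 2.
Proof.
rewrite !enorm_sqr (bigD1_ord ord_max)//= addrC; congr (_ + _).
by apply: eq_bigr => i _; rewrite mxE.
Qed.

Lemma enorm_split1 x : enorm (rV_split x).1 <= enorm x.
Proof.
by rewrite -ler_sqr ?nnegrE ?enorm_ge0// [leRHS]enorm_split lerDl sqr_ge0.
Qed.

Lemma enorm_split2 x : `|(rV_split x).2| <= enorm x.
Proof. exact: coord_le_enorm. Qed.

Lemma enorm_le_split x : enorm x <= enorm (rV_split x).1 + `|(rV_split x).2|.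
Proof.
rewrite -ler_sqr ?nnegrE ?addr_ge0 ?enorm_ge0// enorm_split sqrrD real_normK
  ?num_real//.
by rewrite lerD2r lerDl mulrn_wge0// mulr_ge0// enorm_ge0.
Qed.

Lemma continuous_split1 : continuous (fun x => (rV_split x).1).
Proof.
move=> x; apply/(@cvgrPdist_lt _ _ _ (nbhs x)) => e e0.
apply/nbhs_ballP; exists e => //= y; rewrite mx_norm_ball /ball_/= => xy.
rewrite mx_norm_lt//; apply/forallP => i; rewrite !mxE.
by move: xy; rewrite mx_norm_lt// => /forallP/(_ (lift ord_max i)); rewrite !mxE.
Qed.

End coordinates.

(** * Lipschitz bound for the boundary graph *)

Section lipschitz.
Context {R : realType} {n : nat}.

Lemma diff_partial_sum (f : 'rV[R]_n -> R) x v : differentiable f x ->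
  'D_v f x = \sum_i v 0 i * partial i f x.
Proof.
move=> df; rewrite (deriveE _ df) [in LHS](row_sum_delta v) linear_sum/=.
apply: eq_bigr => i _; rewrite linearZ /= /partial.
by rewrite [X in _ = _ * X](deriveE _ df).
Qed.

(** Hoelder continuity on the compact ball of radius 1/2, used against the origin, bounds the
    gradient there. The ball is convex, so the mean value theorem along a segment gives the
    Lipschitz bound. *)
Lemma C1alpha_lipschitz (al : R) (phi : 'rV[R]_n -> R) : 0 < al ->
  C1alpha_on al (eball 0 1) phi ->
  exists2 L, 0 <= L & forall x y, enorm x <= 1 / 2 -> enorm y <= 1 / 2 ->
    `|phi x - phi y| <= L * enorm (x - y).
Proof.
move=> al0 [dphi hphi].
have Ksub : eball_closed (0 : 'rV[R]_n) (1 / 2) `<=` eball 0 1.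
  by move=> x; rewrite /eball_closed/eball/= subr0; lra.
have [L0 hL] := hphi _ (@compact_eball_closed R n 0 (1 / 2)) Ksub.
have K0 : eball_closed (0 : 'rV[R]_n) (1 / 2) 0.
  by rewrite /eball_closed/= subrr enorm0; lra.
pose B i := `|L0| + `|partial i phi 0|.
have hB x i : enorm x <= 1 / 2 -> `|partial i phi x| <= B i.
  move=> x2; have Kx : eball_closed (0 : 'rV[R]_n) (1 / 2) x.
    by rewrite /eball_closed/= subr0.
  rewrite -(subrK (partial i phi 0) (partial i phi x)) (le_trans (ler_normD _
    _))//.
  rewrite lerD2r (le_trans (hL _ _ _ Kx K0))// subr0.
  apply: (@le_trans _ _ (`|L0| * enorm x `^ al)).
    by rewrite ler_wpM2r ?powR_ge0// ler_norm.
  rewrite -[leRHS]mulr1 ler_wpM2l//.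
  apply: (@le_trans _ _ (1 `^ al)); last by rewrite powR1.
  by rewrite ge0_ler_powR ?nnegrE ?enorm_ge0 ?(ltW al0)//; lra.
exists (\sum_i B i); first by apply: sumr_ge0 => i _; rewrite addr_ge0.
move=> x y x2 y2; rewrite distrC.
pose z (t : R) : 'rV[R]_n := t *: (y - x) + x.
have zE (t : R) : 0 <= t -> t <= 1 -> enorm (z t) <= 1 / 2.
  move=> t0 t1; rewrite /z (_ : _ + x = t *: y + (1 - t) *: x); last first.
    by rewrite scalerBr scalerBl scale1r -addrA [- _ + x]addrC.
  rewrite (le_trans (ler_enormD _ _))// !enormZ !ger0_norm ?subr_ge0//.
  have h1 : t * enorm y <= t * (1 / 2) by rewrite ler_wpM2l.
  have h2 : (1 - t) * enorm x <= (1 - t) * (1 / 2) by rewrite ler_wpM2l ?subr_ge0.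
  by lra.
have dz (t : R) : 0 <= t -> t <= 1 -> differentiable phi (z t).
  by move=> t0 t1; apply: dphi; rewrite /eball/= subr0 (le_lt_trans (zE t t0
    t1))//; lra.
pose g t := phi (z t).
have gP (t : R) : 0 <= t -> t <= 1 ->
    is_derive t 1 g (\sum_i (y - x) 0 i * partial i phi (z t)).
  move=> t0 t1; have d := dz t t0 t1; rewrite -diff_partial_sum//.
  have zh (h : R) : phi (h *: (y - x) + z t) = g (h *: 1 + t).
    by rewrite /g /z [_%:A]mulr1 addrA -scalerDl.
  have [E D] := eq_derive_line zh.
  by apply: DeriveDef; [apply: D; exact: diff_derivable|rewrite E].
have [||c c01] := @MVT_segment R g (fun t => \sum_i (y - x) 0 i * partial i phi
  (z t)) 0 1 ler01.
- by move=> t; rewrite in_itv/= => /andP[t0 t1]; apply: gP; exact: ltW.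
- apply: derivable_within_continuous => t; rewrite in_itv/= => /andP[t0 t1].
  by have [] := gP t t0 t1.
move: c01; rewrite in_itv/= => /andP[c0 c1].
rewrite /g /z scale1r subrK scale0r add0r subr0 mulr1 => ->.
rewrite (le_trans (ler_norm_sum _ _ _))// mulr_suml; apply: ler_sum => i _.
rewrite normrM mulrC ler_pM//; first by apply: hB; exact: zE.
by rewrite enormB; exact: coord_le_enorm.
Qed.

End lipschitz.

(** * Whitney cover near the boundary *)

Section whitney.
Context {R : realType}.

Lemma truncn_eq_dist (a b : R) : 0 <= a -> 0 <= b ->
  Num.truncn a = Num.truncn b -> `|a - b| < 1.
Proof.
move=> /truncn_itv/andP[a1 a2] /truncn_itv/andP[b1 b2] ab.
rewrite -ab in b1 b2; rewrite -natr1 in a2; rewrite -natr1 in b2.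
by rewrite ltr_norml; apply/andP; split; lra.
Qed.

Lemma truncn_leq (a : R) (N : nat) : 0 <= a -> a <= N%:R -> (Num.truncn a <= N)%N.
Proof.
move=> /truncn_itv/andP[a1 _] aN; rewrite -(ler_nat R).
exact: le_trans aN.
Qed.

Lemma truncn_lt_add (a a' b : R) : 0 <= a -> 0 <= a' -> 0 <= b -> a <= a' + b ->
  (Num.truncn a < Num.truncn a' + (Num.truncn b).+2)%N.
Proof.
move=> /truncn_itv/andP[a1 _] /truncn_itv/andP[_ a2] /truncn_itv/andP[_ b2] ab.
rewrite -(ltr_nat R) natrD (le_lt_trans a1)//.
rewrite -natr1 in a2; rewrite -[_.+2%:R]natr1; lra.
Qed.

(** Indices less than [q] apart are separated by their residues: this lets finitely many colours
    distinguish neighbouring cells. *)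
Lemma eqn_mod_close (q i j : nat) : (i %% q = j %% q)%N ->
  (i < j + q)%N -> (j < i + q)%N -> i = j.
Proof.
wlog ij : i j / (i <= j)%N.
  move=> h e a b; have [ij|/ltnW ij] := leqP i j; first exact: h.
  by apply/esym; exact: h.
move=> /esym/eqP; rewrite eqn_mod_dvd// => qd _ jq.
apply/eqP; rewrite eqn_leq ij/= -subn_eq0; apply/eqP.
have [->//|d0] := posnP (j - i)%N.
by have := dvdn_leq d0 qd; rewrite leqNgt ltn_subLR// jq.
Qed.

(** [k] is the least index satisfying the lower bound; minimality gives the upper one, and
    [rho <= 1] settles k = 0. *)
Lemma dyadic_layer (rho : R) : 0 < rho -> rho <= 1 ->
  exists k, (2 ^+ k)^-1 / 2 < rho <= (2 ^+ k)^-1.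
Proof.
move=> r0 r1.
have ex : exists k, (2 ^+ k)^-1 / 2 < rho.
  have [k /= kr] : exists k : nat, k.+1%:R^-1 < rho.
    by have [k _ /(_ k (leqnn k))] := near_infty_natSinv_lt (PosNum r0); exists k.
  exists k; rewrite (le_lt_trans _ kr)// -invfM lef_pV2 ?posrE ?mulr_gt0
    ?exprn_gt0//.
  by rewrite -exprSr -natrX ler_nat; apply/ltnW/ltn_expl.
case: (ex_minnP ex) => k kr kmin; exists k; rewrite kr/=.
case: k kr kmin => [|k] kr kmin; first by rewrite expr0 invr1.
rewrite leNgt; apply/negP => h; suff : (k.+1 <= k)%N by rewrite ltnn.
by apply: kmin; rewrite -invfM -exprSr.
Qed.

Lemma graph_height_continuous n (phi : 'rV[R]_n -> R) (x : 'rV[R]_n.+1) :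
  differentiable phi (rV_split x).1 ->
  {for x, continuous (fun y => (rV_split y).2 - phi (rV_split y).1)}.
Proof.
move=> dphi; have c2 : {for x, continuous (fun y : 'rV[R]_n.+1 => y 0 ord_max)}.
  exact: coord_continuous.
have c1 : {for x, continuous (fun y : 'rV[R]_n.+1 => phi (rV_split y).1)}.
  apply: (@continuous_comp _ _ _ (fun y => (rV_split y).1) phi).
    exact: continuous_split1.
  exact: differentiable_continuous dphi.
exact: (continuousB c2 c1).
Qed.

(** In the unit ball the domain is where the height above the graph, a continuous function, is
    positive. *)
Lemma C1alpha_domain_open n alpha (Omega : set 'rV[R]_n.+1) :
  C1alpha_domain alpha Omega -> open (ball_part Omega 1).
Proof.
move=> [phi [dphi _] [-> _]]; rewrite openE => x [/= px x1].
have d0 : nbhs ((rV_split x).2 - phi (rV_split x).1) [set t | 0 < t].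
  by apply: open_nbhs_nbhs; split; [exact: open_gt|rewrite /= subr_gt0].
have dx : differentiable phi (rV_split x).1.
  by apply: dphi; move: x1; rewrite /eball/= !subr0; apply: le_lt_trans;
    exact: enorm_split1.
have nx := graph_height_continuous dx d0.
apply: filterI; last by apply: open_nbhs_nbhs; split; [exact: open_eball|].
have {nx} : nbhs x [set y | 0 < (rV_split y).2 - phi (rV_split y).1] := nx.
by apply: (@filterS _ (nbhs x)) => y; rewrite /= subr_gt0.
Qed.

(* The balls are centred at dyadic cells in the coordinates (x', x^n - phi x')
   straightening the boundary.  The colouring col, for which balls of the same
   colour are disjoint, encodes the bounded overlap of the cover. *)
Lemma whitney_cover n alpha (Omega : set 'rV[R]_n.+1) : 0 < alpha ->
  C1alpha_domain alpha Omega -> boundary Omega 0 ->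
  exists (c K : R) (A : nat) (T : nat -> finType) (Tc : finType)
    (act : forall k, pred (T k)) (z : forall k, T k -> 'rV[R]_n.+1)
    (col : forall k, T k -> Tc),
  [/\ 0 < c <= 1, 0 <= K, forall k, (#|T k| <= A * (2 ^ k) ^ n)%N,
   forall k (t : T k), act k t ->
     eball (z k t) (c / 2 ^+ k) `<=` ball_part Omega 1 /\
     exists2 y, bdry_part Omega (1 / 2) y &
       forall x, eball (z k t) (c / 2 ^+ k) x -> enorm (x - y) <= K * (c / 2 ^+
         k) &
   (forall x, ball_part Omega (1 / 12) x -> exists k (t : T k),
     act k t /\ enorm (x - z k t) < c / 2 ^+ k / 4) /\
   forall k (t : T k) k' (t' : T k') x,
     act k t -> act k' t' -> col k t = col k' t' ->
     eball (z k t) (c / 2 ^+ k) x -> eball (z k' t') (c / 2 ^+ k') x ->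
     Tagged T t = Tagged T t'].
Proof.
move=> al0 [phi C1phi [UE BE]] bd0.
have [L L0 lip] := C1alpha_lipschitz al0 C1phi.
have phi0 : phi 0 = 0.
  have : bdry_part Omega 1 0 by split => //; rewrite /eball/= subrr enorm0 ltr01.
  rewrite BE => -[h _].
  have {h} : (rV_split (0 : 'rV[R]_n.+1)).2 = phi (rV_split 0).1 := h.
  by rewrite rV_split0.
pose Lam := 1 + L; have Lam1 : 1 <= Lam by rewrite lerDl.
have Lam0 : 0 < Lam by rewrite (lt_le_trans ltr01).
(* The height above the graph is a Lipschitz substitute for the distance to the boundary. *)
pose del (x : 'rV[R]_n.+1) := (rV_split x).2 - phi (rV_split x).1.
(* The truncation makes the layers k >= 0 suffice. A point of height below 1/4 in the ball of radius
   1/12 has its vertical projection within 1/12 + 1/4 < 1/2 of the origin, where (b) applies. *)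
pose rho x := Num.min (del x) (1 / 4).
have del_lip x y : enorm x <= 1 / 2 -> enorm y <= 1 / 2 ->
    `|del x - del y| <= Lam * enorm (x - y).
  move=> x2 y2; rewrite /del.
  have h1 := lip _ _ (le_trans (enorm_split1 x) x2) (le_trans (enorm_split1 y)
    y2).
  have h2 := enorm_split2 (x - y); have h3 := enorm_split1 (x - y).
  rewrite rV_splitB2 in h2; rewrite rV_splitB1 in h3.
  rewrite opprB addrACA [- phi _ + _]addrC.
  rewrite (_ : _ + _ = ((rV_split x).2 - (rV_split y).2) -
    (phi (rV_split x).1 - phi (rV_split y).1)); last by ring.
  rewrite (le_trans (ler_normB _ _))// /Lam mulrDl mul1r lerD//.
  by rewrite (le_trans h1)// ler_wpM2l.
have UP x : ball_part Omega 1 x <-> 0 < del x /\ enorm x < 1.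
  by rewrite UE /eball/= /del subr_gt0 subr0.
have UP' x : ball_part Omega (1 / 12) x -> 0 < del x /\ enorm x < 1 / 12.
  move=> [Ox]; rewrite /eball/= subr0 => x12; split => //.
  have : ball_part Omega 1 x by split => //; rewrite /eball/= subr0; lra.
  by move=> /UP[].
have del_le x : enorm x <= 1 / 2 -> `|del x| <= Lam * enorm x.
  move=> x2; have := del_lip x 0 x2;
    rewrite enorm0 subr0 /del rV_split0 phi0 subr0.
  by rewrite subr0; apply; lra.
(* [del] has Lipschitz constant [Lam], so it varies by at most [d k / 16] on a ball of radius
   [c * d k]: the ball stays in the domain and [rho] stays comparable to [d k]. *)
pose c := (16 * Lam)^-1; have c0 : 0 < c by rewrite invr_gt0 mulr_gt0.
have cL : 16 * (Lam * c) = 1 by rewrite mulrA mulfV// gt_eqF// mulr_gt0.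
have c1 : c <= 1 / 16 by rewrite -(mul1r c); have := ler_wpM2r (ltW c0) Lam1; lra.
pose d k : R := (2 ^+ k)^-1.
have d0 k : 0 < d k by rewrite invr_gt0 exprn_gt0.
have d1 k : d k <= 1 by rewrite invf_le1 ?exprn_gt0// exprn_ege1// ler1n.
have rE k : c / 2 ^+ k = c * d k by [].
have r0 k : 0 < c * d k by rewrite mulr_gt0.
have rd k : 16 * (Lam * (c * d k)) = d k by rewrite !mulrA -[16 * Lam * c]mulrA
  cL mul1r.
have rle k : c * d k <= d k / 16.
  by have := ler_wpM2r (ltW (r0 k)) Lam1; have := rd k; lra.
pose lay k (x : 'rV[R]_n.+1) := d k / 2 < rho x <= d k.
have near_ball k x y : ball_part Omega (1 / 12) x -> eball x (c * d k) y ->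
    enorm y <= 1 / 2 /\ `|del y - del x| <= d k / 16.
  move=> /UP'[dx x12]; rewrite /eball/= => yx.
  have y2 : enorm y <= 1 / 2.
    have := enorm_triangle x y 0; rewrite !subr0.
    by have := rle k; have := d1 k; lra.
  have := del_lip y x y2 => h; split => //; rewrite (le_trans (h _))//;
    first by lra.
  have := ler_wpM2l (ltW Lam0) (ltW yx); have := rd k; lra.
have rho_ball k x y : ball_part Omega (1 / 12) x -> lay k x -> eball x (c * d
  k) y ->
    d k / 2 - d k / 16 < rho y <= d k + d k / 16.
  move=> Ux /andP[l1 l2] yx; have [_] := near_ball k x y Ux yx.
  rewrite ler_norml => /andP[h1 h2]; move: l1 l2; rewrite /rho lt_min ge_min.
  move=> /andP[l1 l1'] /orP l2; have dk := d0 k; rewrite lt_min ge_min;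
    apply/andP; split.
    by apply/andP; split; lra.
  by apply/orP; case: l2 => l2; [left|right]; lra.
(* Cells of side [d k / m] in the straightened coordinates have Euclidean diameter at most (Lam n +
   1) d_k / m; this [m] makes it less than c d_k / 4. *)
have [m m0 mbig] : exists2 m : nat, (0 : R) < m%:R &
    64 * Lam * (Lam * n%:R + 1) < m%:R.
  exists (Num.truncn (64 * Lam * (Lam * n%:R + 1))).+1; first by rewrite ltr0n.
  have h : 0 <= 64 * Lam * (Lam * n%:R + 1).
    by apply: mulr_ge0; [apply: mulr_ge0|apply: addr_ge0 => //;
      apply: mulr_ge0] => //; exact: ltW.
  by have /andP[] := truncn_itv h.
(* In layer [k] either del <= d_k, or d_k >= 1/4 and del <= Lam / 12 <= Lam d_k. The number of
   height indices is thus bounded independently of [k], and only the [n] horizontal ones grow with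
   it. *)
have [J JE] : exists J, J = Num.truncn (m%:R * (1 + Lam)) by eexists.
pose T k : finType := ({ffun 'I_n -> 'I_(2 * m * 2 ^ k).+1} * 'I_J.+1)%type.
(* The shift by 1 makes the number to be truncated nonnegative. *)
pose a k (x : 'rV[R]_n.+1) (l : 'I_n) : R := m%:R * (x 0 (lift ord_max l) + 1)
  * 2 ^+ k.
pose b k (x : 'rV[R]_n.+1) : R := m%:R * del x * 2 ^+ k.
pose cell k x : T k := ([ffun l => inord (Num.truncn (a k x l))],
  inord (Num.truncn (b k x))).
have e2 k : (0 : R) < 2 ^+ k by rewrite exprn_gt0.
have coord_le (x : 'rV[R]_n.+1) (l : 'I_n) : `|x 0 (lift ord_max l)| <= enorm x
  by exact: coord_le_enorm.
have a_bd k x (l : 'I_n) : ball_part Omega (1 / 12) x ->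
    0 <= a k x l /\ (Num.truncn (a k x l) <= 2 * m * 2 ^ k)%N.
  move=> /UP'[_ x12]; have := coord_le x l; rewrite ler_norml => /andP[h1 h2].
  have a0 : 0 <= a k x l by rewrite !mulr_ge0 ?(ltW (e2 k))//; lra.
  split => //; apply: truncn_leq => //; rewrite /a !natrM natrX.
  rewrite ler_wpM2r ?(ltW (e2 k))// mulrC ler_wpM2r ?(ltW m0)//; lra.
have b_bd k x : ball_part Omega (1 / 12) x -> lay k x ->
    0 <= b k x /\ (Num.truncn (b k x) <= J)%N.
  move=> /UP'[dx x12] /andP[_ l2].
  have b0 : 0 <= b k x by rewrite !mulr_ge0 ?(ltW (e2 k)) ?(ltW dx).
  split => //; rewrite JE; apply: le_truncn;
    rewrite /b -mulrA ler_wpM2l ?(ltW m0)//.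
  rewrite -ler_pdivlMr//.
  have x2 : enorm x <= 1 / 2 by lra.
  have := del_le x x2; have := ler_norm (del x) => h1 h2.
  have Lx : Lam * enorm x <= Lam * (1 / 12) by rewrite ler_wpM2l ?(ltW Lam0)//
    ltW.
  have dk := d0 k; have Ld : 0 <= Lam * d k by rewrite mulr_ge0 ?(ltW Lam0)// ltW.
  move: l2; rewrite /rho ge_min -/(d k) mulrDl mul1r => /orP[|] l2; first by lra.
  have := ler_wpM2l (ltW Lam0) l2; lra.
have cell_close k x y : ball_part Omega (1 / 12) x -> ball_part Omega (1 / 12)
  y ->
    lay k x -> lay k y -> cell k x = cell k y -> enorm (x - y) < c * d k / 4.
  move=> Ux Uy lx ly [cxy1 cxy2].
  have mdk : 0 < d k / m%:R by rewrite divr_gt0.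
  have abs_lt (u v : R) : `|m%:R * u * 2 ^+ k - m%:R * v * 2 ^+ k| < 1 ->
      `|u - v| < d k / m%:R.
    rewrite -mulrBl -mulrBr !normrM (ger0_norm (ltW m0)) (ger0_norm (ltW (e2 k))).
    by rewrite ltr_pdivlMr// /d -[(2 ^+ k)^-1]div1r ltr_pdivlMr// [`|u - v| *
      _]mulrC.
  have h1 (l : 'I_n) : `|x 0 (lift ord_max l) - y 0 (lift ord_max l)| <= d k /
    m%:R.
    have [ax1 ax2] := a_bd k x l Ux; have [ay1 ay2] := a_bd k y l Uy.
    have tr : Num.truncn (a k x l) = Num.truncn (a k y l).
      have := congr1 (fun g : {ffun 'I_n -> 'I_(2 * m * 2 ^ k).+1} => val (g
        l)) cxy1.
      by rewrite !ffunE /= !inordK ?ltnS.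
    have := abs_lt _ _ (truncn_eq_dist ax1 ay1 tr).
    by rewrite opprD addrACA subrr addr0 => /ltW.
  have h2 : `|del x - del y| < d k / m%:R.
    have [bx1 bx2] := b_bd k x Ux lx; have [by1 by2] := b_bd k y Uy ly.
    have tr : Num.truncn (b k x) = Num.truncn (b k y).
      by have := congr1 (fun j : 'I_J.+1 => val j) cxy2; rewrite /= !inordK ?ltnS.
    exact: abs_lt (truncn_eq_dist bx1 by1 tr).
  have [_ x12] := UP' _ Ux; have [_ y12] := UP' _ Uy.
  set w := (rV_split x).1 - (rV_split y).1.
  have w_le : enorm w <= n%:R * (d k / m%:R).
    rewrite (le_trans (enorm_le_sum _))//.
    apply: (@le_trans _ _ (\sum_(l < n) d k / m%:R)).
      by apply: ler_sum => l _; rewrite !mxE.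
    by rewrite sumr_const card_ord mulr_natl.
  have h3 : `|phi (rV_split x).1 - phi (rV_split y).1| <= L * enorm w.
    by apply: lip; rewrite (le_trans (enorm_split1 _))//; lra.
  have h4 : `|(rV_split x).2 - (rV_split y).2| < d k / m%:R + L * enorm w.
    rewrite (_ : _ - _ = (del x - del y) + (phi (rV_split x).1 - phi (rV_split
      y).1)).
      by rewrite (le_lt_trans (ler_normD _ _))// ltr_leD.
    by rewrite /del; ring.
  have h5 := enorm_le_split (x - y); rewrite rV_splitB1 rV_splitB2 -/w in h5.
  have h6 : enorm (x - y) < Lam * (n%:R * (d k / m%:R)) + d k / m%:R.
    have := ler_wpM2l (ltW Lam0) w_le;
      rewrite /Lam [(1 + L) * enorm w]mulrDl mul1r; lra.
  rewrite (lt_le_trans h6)//.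
  rewrite (_ : _ + _ = (Lam * n%:R + 1) * d k / m%:R); last by ring.
  rewrite ler_pdivrMr//.
  have := rd k => rdk.
  have h7 : (c * d k) * (64 * Lam * (Lam * n%:R + 1)) <= c * d k * m%:R.
    by rewrite ler_wpM2l ?(ltW (r0 k))// ltW.
  rewrite (_ : c * d k * (64 * Lam * (Lam * n%:R + 1)) =
    4 * (Lam * n%:R + 1) * (16 * (Lam * (c * d k)))) in h7; last by ring.
  rewrite rdk in h7; rewrite (_ : c * d k / 4 * m%:R = (c * d k * m%:R) / 4);
    last by ring.
  lra.
(* Only cells that meet their layer in the small ball are used, and the centre is one such common
   point. *)
pose act k : pred (T k) := fun t =>
  `[< exists x, [/\ ball_part Omega (1 / 12) x, lay k x & cell k x = t] >].
have /choice[zf zP] : forall kt : {k & T k}, exists x, act (tag kt) (tagged kt) ->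
    [/\ ball_part Omega (1 / 12) x, lay (tag kt) x & cell (tag kt) x = tagged kt].
  case=> k t /=; have [/asboolP[x xP]|nt] := boolP (act k t); first by exists x.
  by exists 0.
pose z k (t : T k) := zf (Tagged T t).
have zP' k (t : T k) : act k t ->
    [/\ ball_part Omega (1 / 12) (z k t), lay k (z k t) & cell k (z k t) = t].
  exact: (zP (Tagged T t)).
(* Centres of meeting balls of one layer are at most 2 c d_k apart, so their horizontal indices
   differ by less than Q + 1 and are determined by residues modulo Q + 1. *)
have [Q QE] : exists Q, Q = (Num.truncn (2 * c * m%:R)).+1 by eexists.
pose Tc : finType := ('I_3 * {ffun 'I_n -> 'I_Q.+1} * 'I_J.+1)%type.
(* Meeting balls have layers at most 1 apart, so the layer is recorded modulo 3. The height index,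
   having boundedly many values, is kept whole. *)
pose col k (t : T k) : Tc :=
  (inord (k %% 3), [ffun l => inord (t.1 l %% Q.+1)], t.2).
(* A centre is at most d_k = 16 Lam c d_k from the chosen boundary point, and the radius c d_k is
   added to it. *)
exists c, (1 + 16 * Lam), ((2 * m).+1 ^ n * J.+1)%N, T, Tc, act, z, col; split.
- by rewrite c0/=; lra.
- by rewrite addr_ge0// mulr_ge0// ltW.
- move=> k; rewrite card_prod card_ffun !card_ord [leqRHS]mulnAC leq_mul2r.
  apply/orP; right; rewrite -expnMn.
  have leE i j e : (i <= j)%N -> (i ^ e <= j ^ e)%N.
    by move=> ij; case: e => [//|e]; rewrite leq_exp2r.
  by apply: leE; rewrite mulSn -[leqLHS]add1n leq_add2r expn_gt0.
- move=> k t /zP'[Ux lx cx]; rewrite rE; have [dx x12] := UP' _ Ux.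
  split=> [y yx|].
    have [y2 h] := near_ball k _ y Ux yx; apply/UP; split; last by lra.
    move: lx h; rewrite /lay /rho lt_min ler_norml => /andP[/andP[l1 _] _]
      /andP[h _].
    by have := d0 k; lra.
  (* A low centre is projected vertically onto the graph; for a high one d_k >= 1/4, and the origin
     is close enough. *)
  have [d4|d4] := ltP (del (z k t)) (1 / 4).
    have l2 : del (z k t) <= d k.
      move: lx; rewrite /lay /rho => /andP[_]; rewrite ge_min => /orP[//|]; lra.
    pose y := rV_join ((rV_split (z k t)).1, phi (rV_split (z k t)).1).
    have yE : rV_split y = ((rV_split (z k t)).1, phi (rV_split (z k t)).1).
      exact: rV_joinK.
    have zy : enorm (z k t - y) <= del (z k t).
      rewrite (le_trans (enorm_le_split _))// rV_splitB1 rV_splitB2 yE /= subrr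
        enorm0 add0r.
      by rewrite -/(del _) gtr0_norm.
    have y2 : enorm y < 1 / 2.
      have := enorm_triangle (z k t) y 0; rewrite !subr0 enormB; lra.
    have By : bdry_part Omega 1 y.
      have yy : (rV_split y).2 = phi (rV_split y).1 by rewrite yE.
      rewrite BE; split; first exact: yy.
      by rewrite /eball/= subr0; lra.
    exists y; first by split; [case: By|rewrite /eball/= subr0].
    move=> x; rewrite /eball/= => xz.
    have := enorm_triangle (z k t) x y; have := rd k; lra.
  exists 0; first by split => //; rewrite /eball/= subrr enorm0; lra.
  move=> x; rewrite /eball/= subr0 => xz.
  have : 1 / 4 <= d k.
    move: lx; rewrite /lay /rho => /andP[_]; rewrite ge_min => /orP[|]; lra.
  have := enorm_triangle (z k t) x 0; rewrite !subr0; have := rd k; lra.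
- split.
    move=> x Ux; have [dx x12] := UP' _ Ux.
    have [k lk] : exists k, lay k x.
      apply: dyadic_layer; rewrite /rho; first by rewrite lt_min dx/=; lra.
      by rewrite ge_min; apply/orP; right; lra.
    have ak : act k (cell k x) by apply/asboolP; exists x.
    exists k, (cell k x); split => //; have [Uz lz cz] := zP' _ _ ak.
    by rewrite rE; apply: cell_close => //; rewrite cz.
  move=> k t k' t' x /zP'[Uz lz cz] /zP'[Uz' lz' cz'] cc xz xz'.
  rewrite rE in xz; rewrite rE in xz'.
  have /andP[r1 r2] := rho_ball k _ x Uz lz xz.
  have /andP[r1' r2'] := rho_ball k' _ x Uz' lz' xz'.
  case: cc => cc1 cc2 cc3.
  (* At a common point [rho] lies between 7/16 and 17/16 of both scales, and 17/7 < 4. *)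
  have dlt i j : d i < 4 * d j -> (j < i.+2)%N.
    rewrite /d ltr_pdivlMr// mulrC ltr_pdivrMr// => h.
    have : (2 : R) ^+ j < 2 ^+ i.+2 by rewrite !exprS mulrA -natrM.
    by rewrite ltr_eXn2l ?ltr1n.
  have kk' : k = k'.
    have h1 : (k' < k.+2)%N by apply: dlt; lra.
    have h2 : (k < k'.+2)%N by apply: dlt; lra.
    have := congr1 (fun j : 'I_3 => val j) cc1;
      rewrite /= !inordK ?ltn_pmod// => h3.
    by apply: (eqn_mod_close h3); rewrite addn3; [exact: leqW h2|exact: leqW h1].
  subst k'; congr (Tagged _ _); rewrite -cz -cz'.
  case: t t' cz cz' cc2 cc3 {cc1} Uz Uz' lz lz' xz xz' => t1 t2 [t1' t2'] cz
    cz' /= cc2 cc3 Uz Uz' lz lz' xz xz'.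
  rewrite cz cz' cc3; congr pair; apply/ffunP => l.
  have [a1 a2] := a_bd k _ l Uz; have [a1' a2'] := a_bd k _ l Uz'.
  set z1 := z k (t1, t2) in cz Uz lz xz a1 a2.
  set z2 := z k (t1', t2') in cz' Uz' lz' xz' a1' a2'.
  have tE : t1 l = Num.truncn (a k z1 l) :> nat.
    by have := congr1 (fun g : T k => val (g.1 l)) cz;
      rewrite /= ffunE inordK ?ltnS.
  have tE' : t1' l = Num.truncn (a k z2 l) :> nat.
    by have := congr1 (fun g : T k => val (g.1 l)) cz';
      rewrite /= ffunE inordK ?ltnS.
  apply: val_inj => /=.
  have := congr1 (fun g : {ffun 'I_n -> 'I_Q.+1} => val (g l)) cc2.
  rewrite !ffunE /= !inordK ?ltn_pmod// => h3.
  have zz : enorm (z1 - z2) <= 2 * (c * d k).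
    move: xz xz'; rewrite /eball/= => xz xz'.
    have := enorm_triangle x z1 z2; rewrite (enormB z1 x); lra.
  have c0m : 0 <= 2 * c * m%:R by rewrite !mulr_ge0 ?(ltW c0) ?(ltW m0).
  have dk2 : d k * 2 ^+ k = 1 by rewrite mulVf ?gt_eqF.
  have adiff u v : enorm (u - v) <= 2 * (c * d k) -> a k u l <= a k v l + 2 * c
    * m%:R.
    move=> uv; have := coord_le (u - v) l;
      rewrite !mxE => /(le_trans (ler_norm _)) h.
    have {h} h := le_trans h uv.
    have h' : m%:R * (u 0 (lift ord_max l) - v 0 (lift ord_max l)) * 2 ^+ k <=
        m%:R * (2 * (c * d k)) * 2 ^+ k.
      by rewrite ler_wpM2r ?(ltW (e2 k))// ler_wpM2l ?(ltW m0).
    rewrite (_ : m%:R * (2 * (c * d k)) * 2 ^+ k = 2 * c * m%:R * (d k * 2 ^+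
      k)) in h'; last by ring.
    by rewrite dk2 mulr1 in h'; rewrite /a; lra.
  apply: (eqn_mod_close h3); rewrite tE tE' QE; apply: truncn_lt_add => //;
    apply: adiff => //.
  by rewrite enormB.
Qed.

End whitney.

(** * Geometric series and bounded overlap *)

Section sums.
Context {R : realType}.

Lemma geometric_sum_le (x : R) M : 0 <= x -> x < 1 ->
  \sum_(k < M) x ^+ k <= (1 - x)^-1.
Proof.
move=> x0 x1; have y0 : 0 < 1 - x by rewrite subr_gt0.
rewrite -[leRHS]mul1r ler_pdivlMr// mulrC.
have := subrX1 x M; rewrite -opprB -[X in _ = X * _]opprB mulNr => /oppr_inj <-.
by rewrite lerBlDr lerDl exprn_ge0.
Qed.

(** The sets containing a given point have distinct colours, so there are at most [#|Tc|] of
    them. *)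
Lemma bounded_overlap d (X : measurableType d) (mu : {measure set X -> \bar R})
    (P Tc : finType) (act : pred P) (B : P -> set X) (col : P -> Tc)
    (U : set X) (h : X -> R) :
  measurable U -> measurable_fun U h -> (forall x, 0 <= h x) ->
  (forall i, act i -> measurable (B i) /\ B i `<=` U) ->
  (forall i j x, act i -> act j -> col i = col j -> B i x -> B j x -> i = j) ->
  (\sum_(i | act i) \int[mu]_(x in B i) (h x)%:E <=
   #|Tc|%:R%:E * \int[mu]_(x in U) (h x)%:E)%E.
Proof.
move=> mU mh h0 BU colP.
have mEh : measurable_fun U (EFin \o h) by exact: measurableT_comp.
rewrite -ge0_integralZl//; last by move=> x _; rewrite lee_fin.
rewrite -big_filter.
pose g i x := if act i then ((EFin \o h) \_ (B i)) x else 0%E.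
have mg i : measurable_fun U (g i).
  have [ai|ai] := boolP (act i); last first.
    by rewrite (_ : g i = cst 0%E)//; apply/funext => x; rewrite /g (negbTE ai).
  rewrite (_ : g i = (EFin \o h) \_ (B i)); last by apply/funext => x;
    rewrite /g ai.
  have [mB BsU] := BU i ai; apply/(measurable_restrict _ mB mU).
  by apply: measurable_funS mEh => // x [].
have g0 i x : U x -> (0 <= g i x)%E.
  by rewrite /g /patch /=; case: ifP => // _; case: ifP => // _; rewrite lee_fin.
rewrite (_ : \sum_(i <- _) _ = \sum_(i <- [seq i <- index_enum P | act i])
  \int[mu]_(x in U) g i x)%E; last first.
  rewrite !big_filter; apply: eq_bigr => i ai; have [mB BsU] := BU i ai.
  rewrite /g ai -integral_mkcondr; congr (integral mu _ _).
  by apply/seteqP; split => [x Bx|x []//]; split => //; exact: BsU.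
rewrite -ge0_integral_sum//.
apply: ge0_le_integral => //.
- by move=> x Ux; apply: sume_ge0 => i _; exact: g0.
- exact: emeasurable_sum.
- by apply: emeasurable_funM.
- move=> x Ux; rewrite big_filter.
  pose S := [set i | act i && (x \in B i)]%SET.
  rewrite (_ : \sum_(i | act i) _ = \sum_(i in S) (h x)%:E)%E; last first.
    rewrite big_mkcond [RHS]big_mkcond; apply: eq_bigr => i _.
    by rewrite inE /g /patch; case: (act i) => //=.
  rewrite sumEFin -EFinM lee_fin sumr_const -[leLHS]mulr_natl ler_wpM2r// ler_nat.
  rewrite -(@card_in_imset _ _ col) ?max_card// => i j.
  rewrite !inE => /andP[ai /set_mem xi] /andP[aj /set_mem xj] cij.
  exact: (colP i j x).
Qed.

End sums.

(** * Summation of the local estimates *)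

Section global_estimate.
Context {R : realType} {n : nat}.
Local Notation mu := (lebesgue_rV R n.+1).

(** The ball estimate is applied to [u] minus the affine function attached to [y], which is of size
    (K r)^(1+al) on the ball; the Hessian found is then also one of [u]. *)
Lemma boundary_local_hessian (p q al ce cb K : R) (Omega : set 'rV[R]_n.+1) :
  1 <= q -> q <= p -> 0 <= al -> al <= 1 -> 0 <= K -> open (ball_part Omega 1) ->
  exists2 C, 0 <= C & forall s F f u (x0 y : 'rV[R]_n.+1) (r N : R),
    interior_W2p_estimate s p ce (ball_part Omega 1) F f ->
    solution s p (ball_part Omega 1) F f u -> Lp_on p%:E (ball_part Omega 1) f ->
    boundary_C1alpha_estimate al cb Omega u ->
    0 < r -> r <= 1 -> eball x0 r `<=` ball_part Omega 1 ->
    bdry_part Omega (1 / 2) y ->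
    (forall x, eball x0 r x -> enorm (x - y) <= K * r) -> 1 <= N ->
    exists2 H, weak_hessian (eball x0 (r / 2)) u H &
      (\int[mu]_(x in eball x0 (r / 2)) (frobenius (H x) `^ q)%:E <=
       (C * (N `^ q * r `^ (n.+1%:R + (al - 1) * q)))%:E +
       (C * N `^ (q - p))%:E * \int[mu]_(x in eball x0 r) (`|f x| `^ p)%:E)%E.
Proof.
move=> q1 qp al0 al1 K0 oU; have p1 := le_trans q1 qp.
have [C C0 CP] := @interior_ball_power_estimate R n.+1 p q al ce `|cb| K q1 qp
  al1 K0 (normr_ge0 _).
exists C => // s F f u x0 y r N est sol fp bdr r0 r1 rU By yK N1.
have [a [b [ul _]]] := bdr y By.
pose v x := u x + affine (- a) (- b) x.
have vE x : v x = u x - (a + \sum_i b 0 i * x 0 i).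
  rewrite /v /affine opprD; congr (_ + (_ + _)); rewrite -sumrN.
  by apply: eq_bigr => i _; rewrite mxE mulNr.
have vS x : eball x0 r x -> `|v x| <= `|cb| * (K * r) `^ (1 + al).
  move=> xr; rewrite vE (le_trans (ul _ (rU _ xr)))//.
  apply: (@le_trans _ _ (`|cb| * enorm (x - y) `^ (1 + al))).
    by rewrite ler_wpM2r ?powR_ge0// ler_norm.
  rewrite ler_wpM2l// ge0_ler_powR ?nnegrE ?enorm_ge0 ?addr_ge0 ?mulr_ge0 ?(ltW
    r0)//.
  exact: yK.
have solv : solution s p (ball_part Omega 1) F f v by exact: solution_affine.
have [H vH HE] := CP s _ F f v x0 r N (measurable_open_rV oU) est solv fp r0 r1
  rU vS N1.
exists H => //; have := weak_hessian_affine a b vH.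
rewrite (_ : (fun x => v x + _) = u)//; apply/funext => x.
rewrite /v -addrA (_ : affine (- a) (- b) x + _ = 0) ?addr0//.
rewrite /affine addrACA addNr add0r -big_split big1//= => i _.
by rewrite mxE mulNr addNr.
Qed.

Lemma global_W2q_estimate (p q al ce cb alpha : R) (Omega : set 'rV[R]_n.+1) :
  1 <= q -> q <= p -> 0 < al -> al <= 1 -> (1 - al) * q < 1 ->
  boundary Omega 0 -> 0 < alpha -> C1alpha_domain alpha Omega ->
  exists C : R, forall s F f u,
    Lp_on p%:E (ball_part Omega 1) f ->
    solution s p (ball_part Omega 1) F f u ->
    interior_W2p_estimate s p ce (ball_part Omega 1) F f ->
    boundary_C1alpha_estimate al cb Omega u ->
    (D2_norm q%:E (ball_part Omega (1 / 12)) u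
     <= C%:E * (1 + Lp_norm p%:E (ball_part Omega 1) f))%E.
Proof.
move=> q1 qp al0 al1 alq bd0 alpha0 dom.
have q0 : 0 < q by rewrite (lt_le_trans ltr01).
have p0 : 0 < p by exact: lt_le_trans qp.
have oU := C1alpha_domain_open dom.
set U := ball_part Omega 1 in oU *; set V := ball_part Omega (1 / 12).
have oV : open V.
  rewrite /V (_ : ball_part Omega (1 / 12) = U `&` eball 0 (1 / 12)).
    by apply: openI => //; exact: open_eball.
  apply/seteqP; split => x; last by move=> [[]].
  move=> [Ox x12]; split => //; split => //.
  by move: x12; rewrite /eball/=; lra.
have mU := measurable_open_rV oU; have mV := measurable_open_rV oV.
have [c [K [A [T [Tc [act [z [col [c01 K0 cardT actP]]]]]]]]] :=
  whitney_cover alpha0 dom bd0.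
case=> cov colP.
have /andP[c0 c1] := c01.
have [C C0 CP] := boundary_local_hessian ce cb q1 qp (ltW al0) al1 K0 oU.
pose r k := c / 2 ^+ k.
have r0 k : 0 < r k by rewrite divr_gt0// exprn_gt0.
have r1 k : r k <= 1.
  by rewrite ler_pdivrMr ?exprn_gt0// mul1r (le_trans c1)// exprn_ege1// ler1n.
(* [th] is the exponent of the radius in the local estimate. A layer has O(2^(kn)) balls, so it
   contributes a multiple of [x ^+ k], where n - th = (1 - al) q - 1 < 0. *)
pose th := n.+1%:R + (al - 1) * q.
pose x := (2 : R) `^ (n%:R - th).
have x0 : 0 <= x by exact: powR_ge0.
have x1 : x < 1.
  rewrite /x /powR pnatr_eq0/= -[ltRHS]expR0 ltr_expR.
  have ln2 : (0 : R) < ln 2 by rewrite ln_gt0// ltr1n.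
  by rewrite pmulr_llt0// /th -natr1; lra.
pose G := A%:R * c `^ th * (1 - x)^-1.
have layer_sum M : \sum_(k < M) #|T k|%:R * r k `^ th <= G.
  rewrite /G; apply: (@le_trans _ _ (\sum_(k < M) A%:R * c `^ th * x ^+ k)).
    apply: ler_sum => k _.
    have rk : r k `^ th = c `^ th * (2 : R) `^ (- (k%:R * th)).
      rewrite /r powRM ?(ltW c0) ?invr_ge0 ?exprn_ge0//; congr (_ * _).
      by rewrite -powR_mulrn// -powRN -powRrM mulNr.
    have xk : x ^+ k = (2 : R) `^ (k%:R * n%:R) * 2 `^ (- (k%:R * th)).
      rewrite -powR_gt0D// -mulrBr mulrC powRrM powR_mulrn ?powR_ge0//.
    have Tk : (#|T k|%:R : R) <= A%:R * 2 `^ (k%:R * n%:R).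
      rewrite powRrM !powR_mulrn ?exprn_ge0 ?powR_ge0// -!natrX -natrM ler_nat.
      exact: cardT.
    rewrite rk xk mulrA -[leRHS]mulrA [c `^ th * _]mulrCA !mulrA.
    by do 2 (rewrite ler_wpM2r ?powR_ge0//).
  rewrite -mulr_sumr ler_wpM2l ?mulr_ge0 ?powR_ge0//.
  exact: geometric_sum_le.
pose n2 : R := (n.+1 * n.+1)%:R.
pose Ctot := n2 `^ q * C * (G + #|Tc|%:R).
have G0 : 0 <= G.
  by rewrite /G !mulr_ge0 ?powR_ge0// invr_ge0 subr_ge0 ltW.
have Ctot0 : 0 <= Ctot by rewrite /Ctot !mulr_ge0 ?powR_ge0 ?addr_ge0.
exists (Ctot `^ q^-1) => s F f u fp sol est bdr.
have f_fin := Lp_on_fin fp.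
have f_ge0 : (0 <= Lp_norm p%:E U f)%E by exact: Lnorm_ge0.
set a := fine (Lp_norm p%:E U f).
have aE : Lp_norm p%:E U f = a%:E by rewrite /a fineK// ge0_fin_numE.
have a0 : 0 <= a by rewrite -lee_fin -aE.
(* Since a <= N, the terms N^(q-p) a^p coming from [f] are at most N^q, and the [q]-th root of the
   total is linear in [N]. *)
pose N := 1 + a; have N1 : 1 <= N by rewrite lerDl.
have N0 : 0 < N by rewrite (lt_le_trans ltr01).
have /choice[Hf HfP] : forall kt : {k & T k}, exists H,
  act (tag kt) (tagged kt) ->
    weak_hessian (eball (z _ (tagged kt)) (r (tag kt) / 2)) u H /\
    (\int[mu]_(x in eball (z _ (tagged kt)) (r (tag kt) / 2)) (frobenius (H x)
      `^ q)%:E <=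
       (C * (N `^ q * r (tag kt) `^ th))%:E +
       (C * N `^ (q - p))%:E *
         \int[mu]_(x in eball (z _ (tagged kt)) (r (tag kt))) (`|f x| `^ p)%:E)%E.
  case=> k t /=; have [at_|nt] := boolP (act k t); last by exists (fun=> 0).
  have [tU [y By yK]] := actP k t at_.
  have [H uH HE] := CP s F f u (z k t) y (r k) N est sol fp bdr (r0 k) (r1 k)
    tU By yK N1.
  by exists H.
pose H k (t : T k) := Hf (Tagged T t).
(* The pairs of a layer and a cell are encoded in [nat] for the gluing. The glued balls have radius
   [r k / 2], where the local Hessians live; their halves are the quarter balls of the Whitney
   cover. *)
pose upk (e : nat) : option {k : nat & T k} := unpickle e.
have upkK (kt : {k : nat & T k}) : upk (pickle kt) = Some kt.
  exact: pickleK.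
pose e_ctr e := if upk e is Some kt then z _ (tagged kt) else 0.
pose e_rad e := if upk e is Some kt then r (tag kt) / 2 else 0.
pose e_hes e := if upk e is Some kt then Hf kt else fun=> 0.
pose D : set nat := [set e | exists k (t : T k),
  upk e = Some (Tagged T t) /\ act k t].
have [||x' Vx'|W uW WP] := @weak_hessian_glue R n.+1 V u D e_ctr e_rad e_hes.
- by move=> e [k [t [et _]]]; rewrite /e_rad et divr_gt0.
- move=> e [k [t [et at_]]]; rewrite /e_rad /e_ctr /e_hes et.
  by have [] := HfP (Tagged T t) at_.
- have [k [t [at_ xt]]] := cov _ Vx'.
  exists (pickle (Tagged T t)); first by exists k, t; rewrite upkK.
  rewrite /e_ctr /e_rad upkK /= (lt_le_trans xt)// /r.
  by rewrite (_ : c / 2 ^+ k / 4 = c / 2 ^+ k / 2 / 2)//; lra.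
have {}WP y : V y -> exists k (t : T k), [/\ act k t, eball (z k t) (r k / 2) y &
    frobenius (W y) <= n2 * frobenius (H k t y)].
  move=> /WP[e [[k [t [et at_]]]]]; rewrite /e_ctr /e_rad /e_hes et /= => yB Wy.
  by exists k, t.
(* At each point of [V] a single [g k t] already dominates the [q]-th power of the norm of [W],
   hence so does their sum. *)
pose g k (t : T k) y : \bar R := if act k t then
  ((fun y => ((n2 * frobenius (H k t y)) `^ q)%:E) \_ (eball (z k t) (r k /
    2))) y else 0%E.
have g0 k t y : (0 <= g k t y)%E.
  by rewrite /g /patch; case: ifP => // _; case: ifP => // _;
    rewrite lee_fin powR_ge0.
have mg k t : measurable_fun setT (g k t).
  have [at_|nt] := boolP (act k t); last first.
    by rewrite (_ : g k t = cst 0%E)//; apply/funext => y; rewrite /g (negbTE nt).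
  rewrite (_ : g k t = (fun y => ((n2 * frobenius (H k t y)) `^ q)%:E) \_
    (eball (z k t) (r k / 2))); last by apply/funext => y; rewrite /g at_.
  apply/(measurable_restrictT _ (measurable_eball _ _)).
  apply: measurableT_comp => //.
  apply: (@measurableT_comp _ _ _ _ _ _ (@powR R ^~ q)) => //.
  apply: measurable_funM; first exact: measurable_cst.
  have [uH _] := HfP (Tagged T t) at_.
  exact: weak_hessian_frobenius_measurable (@open_eball _ _ _ _) uH.
have mW := weak_hessian_frobenius_measurable oV uW.
have mWq : measurable_fun V (fun y => (frobenius (W y) `^ q)%:E).
  apply: measurableT_comp => //.
  by apply: (@measurableT_comp _ _ _ _ _ _ (@powR R ^~ q)).
have msum k : measurable_fun V (fun y => (\sum_(t : T k) g k t y)%E).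
  by apply: measurable_funTS; exact: emeasurable_sum.
have sum0 k y : (0 <= \sum_(t : T k) g k t y)%E by apply: sume_ge0 => t _;
  exact: g0.
have gint k t : act k t -> (\int[mu]_(y in V) g k t y <=
    (n2 `^ q * C * N `^ q * r k `^ th)%:E + (n2 `^ q * C * N `^ (q - p))%:E *
    \int[mu]_(y in eball (z k t) (r k)) (`|f y| `^ p)%:E)%E.
  move=> at_; have [uH HE] := HfP (Tagged T t) at_.
  apply: (@le_trans _ _ (\int[mu]_y g k t y)%E).
    by apply: ge0_subset_integral.
  rewrite /g at_ -integral_mkcond.
  under eq_integral do rewrite powRM ?frobenius_ge0// EFinM.
  rewrite ge0_integralZl//; last 3 first.
  - apply: measurableT_comp => //.
    apply: (@measurableT_comp _ _ _ _ _ _ (@powR R ^~ q)) => //.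
    exact: weak_hessian_frobenius_measurable (@open_eball _ _ _ _) uH.
  - by move=> y _; rewrite lee_fin powR_ge0.
  - by rewrite lee_fin powR_ge0.
  have nq0 : (0 <= (n2 `^ q)%:E)%E by rewrite lee_fin powR_ge0.
  rewrite (le_trans (lee_wpmul2l nq0 HE))// ge0_muleDr.
  - by rewrite muleA -!EFinM !mulrA.
  - by rewrite lee_fin !mulr_ge0 ?powR_ge0.
  - by rewrite mule_ge0 ?lee_fin ?mulr_ge0 ?powR_ge0// integral_ge0// => y _;
    rewrite lee_fin powR_ge0.
  - exact: measurable_eball.
have fU : (\int[mu]_(y in U) (`|f y| `^ p)%:E = (a `^ p)%:E)%E.
  by rewrite -Lp_norm_powR// aE.
(* The overlap bound is for finite families; the first [M] layers form one, and the bound does not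
   depend on [M]. *)
have overlap M : (\sum_(k < M) \sum_(t : T k | act k t)
    \int[mu]_(y in eball (z k t) (r k)) (`|f y| `^ p)%:E <= (#|Tc|%:R * a `^
      p)%:E)%E.
  rewrite (sig_big_dep _ _ (fun (k : 'I_M) (t : T k) =>
    \int[mu]_(y in eball (z k t) (r k)) (`|f y| `^ p)%:E)%E) /=.
  rewrite EFinM -fU.
  apply: (@bounded_overlap _ _ _ mu _ Tc (fun i : {k : 'I_M & T k} => act _
    (tagged i))
    (fun i => eball (z _ (tagged i)) (r (tag i))) (fun i => col _ (tagged i))
    U (fun y => `|f y| `^ p)) => //.
  - apply: (@measurableT_comp _ _ _ _ _ _ (@powR R ^~ p)) => //.
    by apply: measurableT_comp => //; exact: Lp_on_measurable fp.
  - move=> [k t] /= at_; split; first exact: measurable_eball.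
    by have [] := actP k t at_.
  - move=> [k t] [k' t'] y /= at_ at' cc yB yB'.
    have E := colP k t k' t' y at_ at' cc yB yB'.
    have kk : k = k' by apply: val_inj; exact: (congr1 tag E).
    subst k'; congr (Tagged _ _).
    by move/eqP: E; rewrite eq_Tagged => /eqP.
have main : (\int[mu]_(y in V) (frobenius (W y) `^ q)%:E <= (Ctot * N `^ q)%:E)%E.
  apply: (@le_trans _ _ (\int[mu]_(y in V) (\sum_(k <oo) \sum_(t : T k) g k t
    y))%E).
    apply: ge0_le_integral => //.
    - by move=> y _; rewrite lee_fin powR_ge0.
    - by apply: ge0_emeasurable_sum.
    - move=> y /WP[k [t [at_ yB Wy]]].
      apply: (@le_trans _ _ (g k t y)).
        rewrite /g at_ /patch mem_set// lee_fin ge0_ler_powR ?nnegrE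
          ?frobenius_ge0 ?(ltW q0)//.
        by rewrite mulr_ge0// frobenius_ge0.
      apply: (@le_trans _ _ (\sum_(t : T k) g k t y)%E).
        by rewrite (bigD1 t)//= leeDl// sume_ge0.
      apply: le_trans (nneseries_lim_ge k.+1 _) => //.
      by rewrite big_nat_recr//= leeDr// sume_ge0.
  rewrite integral_nneseries//.
  apply: lime_le; first by apply: is_cvg_nneseries => k _ _;
    apply: integral_ge0 => y _.
  near=> M; rewrite big_mkord.
  pose A1 k := n2 `^ q * C * N `^ q * r k `^ th.
  pose be := n2 `^ q * C * N `^ (q - p).
  pose I0 k (t : T k) := (\int[mu]_(y in eball (z k t) (r k)) (`|f y| `^ p)%:E)%E.
  have A10 k : 0 <= A1 k by rewrite !mulr_ge0 ?powR_ge0.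
  have be0 : 0 <= be by rewrite !mulr_ge0 ?powR_ge0.
  have I00 k t : (0 <= I0 k t)%E.
    by apply: integral_ge0 => y _; rewrite lee_fin powR_ge0.
  apply: (@le_trans _ _ (\sum_(k < M) \sum_(t : T k | act k t)
      ((A1 k)%:E + be%:E * I0 k t))%E).
    apply: lee_sum => k _; rewrite ge0_integral_sum//; last first.
      by move=> t; apply: measurable_funTS; exact: mg.
    rewrite [leRHS]big_mkcond; apply: lee_sum => t _; case: ifPn => [at_|nt].
      exact: gint.
    by rewrite integral0_eq// => y _; rewrite /g (negbTE nt).
  under eq_bigr do rewrite big_split/=.
  rewrite big_split/=.
  rewrite (_ : Ctot * N `^ q = n2 `^ q * C * N `^ q * G +
    be * (#|Tc|%:R * N `^ p)); last first.
    have NqE : N `^ q = N `^ (q - p) * N `^ p by rewrite -powR_gt0D// subrK.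
    by rewrite /Ctot /be NqE; ring.
  rewrite EFinD; apply: leeD.
    apply: (@le_trans _ _ (\sum_(k < M) (#|T k|%:R * A1 k)%:E)%E).
      apply: lee_sum => k _; rewrite sumEFin lee_fin big_mkcond/=.
      apply: (@le_trans _ _ (\sum_(t : T k) A1 k)).
        by apply: ler_sum => t _; case: ifP.
      by rewrite sumr_const mulr_natl.
    rewrite sumEFin lee_fin.
    apply: (@le_trans _ _ (n2 `^ q * C * N `^ q * \sum_(k < M) #|T k|%:R * r k
      `^ th)).
      by rewrite mulr_sumr; apply: ler_sum => k _; rewrite /A1 mulrCA.
    by rewrite ler_wpM2l ?layer_sum// !mulr_ge0 ?powR_ge0.
  apply: (@le_trans _ _ (be%:E * \sum_(k < M) \sum_(t : T k | act k t) I0 k t)%E).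
    rewrite ge0_sume_distrr; last by move=> k _; apply: sume_ge0 => t _;
      exact: I00.
    apply: lee_sum => k _.
    by rewrite ge0_sume_distrr// => t _; exact: I00.
  rewrite [leRHS]EFinM; apply: lee_wpmul2l; first by rewrite lee_fin.
  rewrite (le_trans (overlap M))// lee_fin ler_wpM2l//.
  rewrite ge0_ler_powR ?nnegrE ?(ltW p0) ?(ltW N0)//.
  by rewrite /N lerDr.
rewrite aE -EFinD -/N.
apply: (@le_trans _ _ (Lp_norm q%:E V (fun y => frobenius (W y)))).
  by apply: ereal_inf_lbound; exists W.
rewrite Lp_norm_integral//.
under eq_integral => y _ do rewrite (ger0_norm (frobenius_ge0 (W y))).
apply: (@le_trans _ _ ((Ctot * N `^ q)%:E `^ q^-1)%E).
  apply: gt0_ler_poweR => //.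
  - by rewrite invr_ge0 ltW.
  - rewrite in_itv/= leey andbT integral_ge0// => y _; rewrite lee_fin powR_ge0//.
  - by rewrite in_itv/= leey andbT lee_fin mulr_ge0 ?powR_ge0.
rewrite poweR_EFin lee_fin powRM ?powR_ge0// -powRrM mulfV ?gt_eqF// powRr1//.
exact: ltW.
Unshelve. all: by end_near.
Qed.

End global_estimate.

(* The space dimension is n.+1. *)
Theorem theorem5p1 (R : realType) (n : nat) (p alpha0 ce cb : R)
    (Omega : set 'rV[R]_n.+1)
    (p_gt1 : 1 < p) (alpha0_gt0 : 0 < alpha0) (Omega0 : boundary Omega 0) :
  (1 - p^-1 < alpha0 ->
   exists C : R,
     forall (alpha : R) (s : solution_sense)
       (F : 'M[R]_n.+1 -> 'rV[R]_n.+1 -> R) (f u : 'rV[R]_n.+1 -> R),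
       alpha0 <= alpha -> alpha <= 1 ->
       C1alpha_domain alpha Omega ->
       elliptic (ball_part Omega 1) F ->
       Lp_on p%:E (ball_part Omega 1) f ->
       solution s p (ball_part Omega 1) F f u ->
       interior_W2p_estimate s p ce (ball_part Omega 1) F f ->
       boundary_C1alpha_estimate alpha0 cb Omega u ->
       (D2_norm p%:E (ball_part Omega (1 / 12)) u
        <= C%:E * (1 + Lp_norm p%:E (ball_part Omega 1) f))%E)
  /\
  (alpha0 <= 1 - p^-1 ->
   forall p0 : R, 1 <= p0 -> p0 < 1 / (1 - alpha0) ->
   exists C : R,
     forall (alpha : R) (s : solution_sense)
       (F : 'M[R]_n.+1 -> 'rV[R]_n.+1 -> R) (f u : 'rV[R]_n.+1 -> R),
       alpha0 <= alpha -> alpha <= 1 ->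
       C1alpha_domain alpha Omega ->
       elliptic (ball_part Omega 1) F ->
       Lp_on p%:E (ball_part Omega 1) f ->
       solution s p (ball_part Omega 1) F f u ->
       interior_W2p_estimate s p ce (ball_part Omega 1) F f ->
       boundary_C1alpha_estimate alpha0 cb Omega u ->
       (D2_norm p0%:E (ball_part Omega (1 / 12)) u
        <= C%:E * (1 + Lp_norm p%:E (ball_part Omega 1) f))%E).
Proof.
have p1 := ltW p_gt1; have p0 : 0 < p by rewrite (lt_le_trans ltr01).
have key q : 1 <= q -> q <= p -> (1 - alpha0) * q < 1 -> exists C : R,
    forall (alpha : R) (s : solution_sense)
      (F : 'M[R]_n.+1 -> 'rV[R]_n.+1 -> R) (f u : 'rV[R]_n.+1 -> R),
      alpha0 <= alpha -> alpha <= 1 ->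
      C1alpha_domain alpha Omega ->
      elliptic (ball_part Omega 1) F ->
      Lp_on p%:E (ball_part Omega 1) f ->
      solution s p (ball_part Omega 1) F f u ->
      interior_W2p_estimate s p ce (ball_part Omega 1) F f ->
      boundary_C1alpha_estimate alpha0 cb Omega u ->
      (D2_norm q%:E (ball_part Omega (1 / 12)) u
       <= C%:E * (1 + Lp_norm p%:E (ball_part Omega 1) f))%E.
  move=> q1 qp alq.
  (* The constant has to be chosen before [alpha]. The cover is built from any one admissible
     exponent of [Omega]; if there is none, the claim is vacuous. *)
  have [[al [[al1 al2] dom]]|no] := pselect (exists al : R,
      (alpha0 <= al /\ al <= 1) /\ C1alpha_domain al Omega).
    have [C CP] := global_W2q_estimate ce cb q1 qp alpha0_gt0 (le_trans al1 al2)
      alq Omega0 (lt_le_trans alpha0_gt0 al1) dom.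
    by exists C => alpha s F f u _ _ _ _; exact: CP.
  exists 0 => alpha s F f u al1 al2 dom; exfalso; apply: no.
  by exists alpha.
split=> [hal|hal q q1 hq].
  apply: key => //; rewrite -ltr_pdivlMr// div1r; lra.
have al1 : 0 < 1 - alpha0.
  have : 0 < p^-1 by rewrite invr_gt0.
  lra.
have alq : (1 - alpha0) * q < 1 by rewrite mulrC -ltr_pdivlMr.
(* The case assumption says 1 / (1 - alpha0) <= p, which gives the condition q <= p of the
   splitting. *)
apply: key => //; rewrite (le_trans (ltW hq))// ler_pdivrMr//.
have : 1 <= p * (1 - alpha0); last by [].
rewrite mulrC -ler_pdivrMr// div1r; lra.
Qed.
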